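(* Let $n \ge 3$ and let $\mathcal Z : \mathrm{Conv}_{sc}(\mathbb R^n) \to F(\mathbb R^n;\mathbb R)$ be a map. Then $\mathcal Z$ is a continuous and $\mathrm{SL}(n)$ contravariant valuation which is a translation conjugation if and only if there is a constant $c \in \mathbb R$ such that $$\mathcal Z u = u^\ast + c$$ for every $u \in \mathrm{Conv}_{sc}(\mathbb R^n)$.
   Context: $\mathrm{Conv}_{sc}(\mathbb R^n)$ is the set of all lower semi-continuous convex functions $u:\mathbb R^n\to\mathbb R\cup\{\infty\}$ that are proper ($u\not\equiv\infty$) and super-coercive ($\lim_{|x|\to\infty} u(x)/|x|=\infty$). $F(\mathbb R^n;\mathbb R)$ is the set of all functions $f:\mathbb R^n\to\mathbb R$. The Legendre transform is $u^\ast(x)=\sup_{y\in\mathbb R^n}(x\cdot y-u(y))$. $u\vee v$ and $u\wedge v$ denote pointwise maximum and minimum. $\mathcal Z$ is a valuation if $\mathcal Z(u\vee v)+\mathcal Z(u\wedge v)=\mathcal Z u+\mathcal Z v$ whenever $u,v,u\vee v,u\wedge v\in \mathrm{Conv}_{sc}(\mathbb R^n)$. $\mathcal Z$ is continuous if $u_i\to u$ in the sense of epi-convergence (all functions in $\mathrm{Conv}_{sc}(\mathbb R^n)$) implies $\mathcal Z u_i\to\mathcal Z u$ pointwise on $\mathbb R^n$. Epi-convergence $u_i\to u$ means: for every $x\in\mathbb R^n$, $u(x)\le\liminf_i u_i(x_i)$ for all sequences $x_i\to x$, and there is a sequence $x_i\to x$ with $u(x)=\lim_i u_i(x_i)$.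 $\mathcal Z$ is $\mathrm{SL}(n)$ contravariant if $\mathcal Z(u\circ\phi^{-1})=(\mathcal Z u)\circ\phi^{t}$ for all $u$ and all $\phi\in \mathrm{SL}(n)$ (with $\phi^t$ the transpose). For $y\in\mathbb R^n$ write $\tau_y f(x)=f(x-y)$ and $\ell_y(x)=x\cdot y$. $\mathcal Z$ is a translation conjugation if $\mathcal Z(\tau_y u)=\mathcal Z(u)+\ell_y$ and $\mathcal Z(u+\ell_y)=\tau_y\mathcal Z(u)$ for all $u\in \mathrm{Conv}_{sc}(\mathbb R^n)$ and $y\in\mathbb R^n$. *)

(* Defs.v *)
From mathcomp Require Import all_boot all_order all_algebra.
From mathcomp Require Import all_classical all_reals all_analysis.
From mathcomp Require Import ring lra.

Set Implicit Arguments.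
Unset Strict Implicit.
Unset Printing Implicit Defensive.

Import Order.TTheory GRing.Theory Num.Theory.
Import numFieldNormedType.Exports.

Local Open Scope classical_set_scope.
Local Open Scope ring_scope.

Section Conv.
Context {R : realType} {n : nat}.
Implicit Types (x y : 'cV[R]_n) (u v : 'cV[R]_n -> \bar R).

Definition dotp x y : R := \sum_i x i 0 * y i 0.

(* The library's norm on ['cV[R]_n] is the sup norm. *)
Definition enorm x : R := Num.sqrt (dotp x x).

(* In [\bar R], [0 * +oo = 0]; hence for [t = 0] and [t = 1] the inequality is
   an equality, as long as [u] does not take the value [-oo]. *)
Definition econvex u := forall x y (t : R), 0 <= t <= 1 ->
  (u (t *: x + (1 - t) *: y)%R <= t%:E * u x + (1 - t)%:E * u y)%E.

Definition proper u := exists x, u x != +oo%E.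

Definition supercoercive u := forall M : R, exists r : R, forall x,
  r < enorm x -> (M%:E <= u x * (enorm x)^-1%:E)%E.

Definition conv_sc u :=
  [/\ forall x, u x != -oo%E, lower_semicontinuous u, econvex u, proper u
    & supercoercive u].

Definition translate y u := fun x => u (x - y).
Definition add_linear y u := fun x => (u x + (dotp x y)%:E)%E.
Definition comp_inv (phi : 'M[R]_n) u := fun x => u (invmx phi *m x).

Definition legendre u x : \bar R :=
  ereal_sup (range (fun y => (dotp x y)%:E - u y)%E).

Definition epi_cvg (u_ : nat -> 'cV[R]_n -> \bar R) u := forall x,
  (forall x_ : nat -> 'cV[R]_n, x_ @ \oo --> x ->
     (u x <= limn_einf (fun i => u_ i (x_ i)))%E) /\
  (exists2 x_ : nat -> 'cV[R]_n, x_ @ \oo --> x &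
     u_ i (x_ i) @[i --> \oo] --> u x).

Definition l1norm x : R := \sum_i `|x i 0|.

Lemma l1norm_ge0 x : 0 <= l1norm x. Proof. exact: sumr_ge0. Qed.
#[local] Hint Resolve l1norm_ge0 : core.

Lemma coord_l1 x i : `|x i 0| <= l1norm x.
Proof. by rewrite /l1norm (bigD1 i)//= lerDl sumr_ge0. Qed.
#[local] Hint Resolve coord_l1 : core.

Lemma enorm_l1 x : enorm x <= l1norm x.
Proof.
rewrite -[leRHS]ger0_norm// -sqrtr_sqr ler_wsqrtr// expr2 [in leRHS]/l1norm mulr_suml.
apply: ler_sum => i _; rewrite -expr2 -real_normK ?num_real// expr2.
exact: ler_wpM2l.
Qed.

#[local] Hint Resolve enorm_l1 : core.

Lemma l1_enorm x : l1norm x <= n%:R * enorm x.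
Proof.
rewrite mulr_natl -[n in leRHS]card_ord -sumr_const; apply: ler_sum => i _.
rewrite -sqrtr_sqr ler_wsqrtr// expr2 /dotp (bigD1 i)//= lerDl.
by apply: sumr_ge0 => j _; rewrite -expr2 sqr_ge0.
Qed.

#[local] Hint Resolve l1_enorm : core.

Lemma l1norm_triangle x y : l1norm (x + y) <= l1norm x + l1norm y.
Proof. by rewrite -big_split; apply: ler_sum => i _; rewrite mxE ler_normD. Qed.

Lemma dotp_l1norm x y : `|dotp x y| <= l1norm x * l1norm y.
Proof.
apply: le_trans (ler_norm_sum _ _ _) _; rewrite mulr_suml.
by apply: ler_sum => i _; rewrite normrM ler_wpM2l.
Qed.

Lemma mulmx_l1norm (A : 'M[R]_n) :
  exists2 C, 0 < C & forall x, l1norm (A *m x) <= C * l1norm x.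
Proof.
exists (1 + \sum_i \sum_j `|A i j|).
  by rewrite ltr_pwDl// sumr_ge0// => i _; rewrite sumr_ge0.
move=> x; rewrite mulrDl mul1r; apply: ler_wpDl => //.
rewrite mulr_suml; apply: ler_sum => i _; rewrite mxE mulr_suml.
apply: le_trans (ler_norm_sum _ _ _) _.
by apply: ler_sum => j _; rewrite normrM ler_wpM2l.
Qed.

Lemma supercoercive_l1 u : supercoercive u <->
  forall M : R, exists r : R, forall x, r < l1norm x -> ((M * l1norm x)%:E <= u x)%E.
Proof.
split=> su M.
  have [r ru] := su (`|M| * n%:R).
  exists (n%:R * `|r|) => x rx.
  have rx' : `|r| < enorm x.
    rewrite ltNge; apply/negP => xr.
    have := lt_le_trans rx (l1_enorm x).
    by rewrite ltNge => /negP; apply; apply: ler_wpM2l.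
  have x0 : 0 < enorm x by exact: le_lt_trans rx'.
  have := ru x (le_lt_trans (ler_norm _) rx').
  rewrite lee_pdivlMr// => /(le_trans _); apply.
  rewrite -EFinM lee_fin -mulrA.
  apply: (le_trans (ler_wpM2r (l1norm_ge0 x) (ler_norm M))).
  by apply: ler_wpM2l.
have [r ru] := su `|M|.
exists `|r| => x rx.
have x0 : 0 < enorm x by exact: le_lt_trans rx.
rewrite lee_pdivlMr//.
have := ru x (le_lt_trans (ler_norm _) (lt_le_trans rx (enorm_l1 x))).
apply: le_trans; rewrite -EFinM lee_fin.
apply: (le_trans (ler_wpM2r (ltW x0) (ler_norm M))).
by apply: ler_wpM2l.
Qed.

Lemma cV_continuous (T : topologicalType) (f : T -> 'cV[R]_n) :
  (forall i, continuous (fun z => f z i 0)) -> continuous f.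
Proof.
move=> fc z B [P Pz PB].
have : \forall w \near z, forall i, P i 0 (f w i 0).
  by apply: filter_forall => i; apply: fc; exact: Pz.
by apply: filterS => w Pw; apply: PB => i j; rewrite (ord1 j); exact: Pw.
Qed.

Lemma sum_coord_continuous (c : 'I_n -> R) :
  continuous (fun x => \sum_i c i * x i 0).
Proof.
apply: continuous_big => [|i _ x]; first exact: add_continuous.
apply: (@continuousM _ _ (cst (c i)) (fun x => x i 0)); first exact: cst_continuous.
exact: coord_continuous.
Qed.

Lemma mulmx_continuous (A : 'M[R]_n) : continuous (fun x => A *m x).
Proof.
apply: cV_continuous => i.
under eq_fun do rewrite mxE.
exact: sum_coord_continuous.
Qed.

Lemma dotp_continuous y : continuous (fun x => dotp x y).
Proof.
rewrite /dotp; under eq_fun do under eq_bigr do rewrite mulrC.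
exact: sum_coord_continuous.
Qed.

Lemma dotpDl x y z : dotp (x + y) z = dotp x z + dotp y z.
Proof. by rewrite -big_split; apply: eq_bigr => i _; rewrite mxE mulrDl. Qed.

Lemma dotpZl a x z : dotp (a *: x) z = a * dotp x z.
Proof. by rewrite mulr_sumr; apply: eq_bigr => i _; rewrite mxE mulrA. Qed.

Lemma lsc_comp u (f : 'cV[R]_n -> 'cV[R]_n) :
  continuous f -> lower_semicontinuous u -> lower_semicontinuous (u \o f).
Proof.
move=> fc uc x a /uc[V Vfx Vu]; exists (f @^-1` V); first exact: fc.
by move=> y /Vu.
Qed.

Lemma lsc_addr u (g : 'cV[R]_n -> R) :
  continuous g -> lower_semicontinuous u ->
  lower_semicontinuous (fun x => u x + (g x)%:E)%E.
Proof.
move=> gc uc x a; rewrite -lteBlDr// -EFinB => aux.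
have [b ab bu] : exists2 b : R, a - g x < b & (b%:E < u x)%E.
  case: (u x) aux => [r| |]// aux.
  - by exists ((a - g x + r) / 2); move: aux; rewrite !lte_fin; lra.
  - by exists (a - g x + 1); rewrite ?ltry// ltrDl.
have [V Vx Vu] := uc _ _ bu.
exists (V `&` [set y | a - b < g y]).
  apply: filterI => //; apply: (gc x [set z | a - b < z]).
  by apply: open_nbhs_nbhs; split; [exact: open_gt|rewrite /=; lra].
move=> y [/Vu buy /= aby]; rewrite -lteBlDr// -EFinB.
by apply: lt_trans buy; rewrite lte_fin ltrBlDr -ltrBlDl.
Qed.

Lemma conv_sc_translate y u : conv_sc u -> conv_sc (translate y u).
Proof.
case=> uNy lu cu [x0 ux0] su; split.
- by move=> x; exact: uNy.
- apply: (@lsc_comp u (fun x => x - y)) => //.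
  by move=> x; apply: (@continuousB _ _ _ id (cst y)); [exact: cvg_id|exact: cst_continuous].
- move=> x z t t01; rewrite /translate.
  have -> : t *: x + (1 - t) *: z - y = t *: (x - y) + (1 - t) *: (z - y).
    by rewrite !scalerBr addrACA -opprD -scalerDl addrCA subrr addr0 scale1r.
  exact: cu.
- by exists (x0 + y); rewrite /translate addrK.
- apply/supercoercive_l1 => M.
  have [r ru] := (supercoercive_l1 u).1 su (2 * `|M|).
  exists (`|r| + 2 * l1norm y) => x rx.
  have xy : l1norm x <= l1norm (x - y) + l1norm y.
    by rewrite -[x in leLHS](subrK y) l1norm_triangle.
  have y0 := l1norm_ge0 y; have r0 := ler_norm r; have r1 := normr_ge0 r.
  apply: le_trans (ru (x - y) _); last by lra.
  rewrite lee_fin; apply: (le_trans (ler_wpM2r (l1norm_ge0 x) (ler_norm M))).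
  rewrite (mulrC 2) -mulrA; apply: ler_wpM2l => //; lra.
Qed.

Lemma conv_sc_add_linear y u : conv_sc u -> conv_sc (add_linear y u).
Proof.
case=> uNy lu cu [x0 ux0] su; split.
- by move=> x; rewrite /add_linear adde_eq_ninfty negb_or uNy.
- by apply: lsc_addr => //; exact: dotp_continuous.
- have df w : (u w +? (dotp w y)%:E)%E by exact: fin_num_adde_defl.
  move=> x z t t01; rewrite /add_linear dotpDl !dotpZl !muleDr//.
  by rewrite [leRHS]addeACA -!EFinM -EFinD; apply: leeD2r; exact: cu.
- by exists x0; rewrite /add_linear; case: (u x0) ux0.
- apply/supercoercive_l1 => M.
  have [r ru] := (supercoercive_l1 u).1 su (M + l1norm y).
  exists r => x rx; rewrite /add_linear.
  have := leeD (ru x rx) (lexx (dotp x y)%:E); apply: le_trans.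
  rewrite -EFinD lee_fin mulrDl -addrA lerDl mulrC.
  by rewrite -lerBlDl sub0r lerNl; apply: le_trans (dotp_l1norm x y); rewrite -normrN ler_norm.
Qed.

Lemma conv_sc_comp_inv (phi : 'M[R]_n) u :
  \det phi = 1 -> conv_sc u -> conv_sc (comp_inv phi u).
Proof.
move=> phi1 [uNy lu cu [x0 ux0] su].
have phiU : phi \in unitmx by rewrite unitmxE phi1 unitr1.
split.
- by move=> x; exact: uNy.
- by apply: (@lsc_comp u (mulmx (invmx phi))) => //; exact: mulmx_continuous.
- move=> x z t t01; rewrite /comp_inv mulmxDr -!scalemxAr; exact: cu.
- by exists (phi *m x0); rewrite /comp_inv mulKmx.
- apply/supercoercive_l1 => M.
  have [C C0 phiC] := mulmx_l1norm phi.
  have [r ru] := (supercoercive_l1 u).1 su (`|M| * C).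
  exists (C * `|r|) => x rx.
  have xC : l1norm x <= C * l1norm (invmx phi *m x).
    by rewrite -[x in leLHS](mulKVmx phiU).
  have := lt_le_trans rx xC; rewrite ltr_pM2l// => rx'.
  apply: le_trans (ru _ (le_lt_trans (ler_norm r) rx')).
  rewrite lee_fin -mulrA.
  apply: (le_trans (ler_wpM2r (l1norm_ge0 x) (ler_norm M))).
  exact: ler_wpM2l.
Qed.

End Conv.

Record Conv_sc (R : realType) (n : nat) := MkConv {
  conv_fun :> 'cV[R]_n -> \bar R;
  conv_scP : conv_sc conv_fun }.

Section Operators.
Context {R : realType} {n : nat}.

Definition translate_conv y (u : Conv_sc R n) : Conv_sc R n :=
  MkConv (conv_sc_translate y (conv_scP u)).

Definition add_linear_conv y (u : Conv_sc R n) : Conv_sc R n :=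
  MkConv (conv_sc_add_linear y (conv_scP u)).

Definition comp_inv_conv phi (phi1 : \det phi = 1) (u : Conv_sc R n) :
  Conv_sc R n := MkConv (conv_sc_comp_inv phi1 (conv_scP u)).

Variable Z : Conv_sc R n -> 'cV[R]_n -> R.

Definition valuation := forall (u v : Conv_sc R n)
  (umax : conv_sc (fun x => maxe (u x) (v x)))
  (umin : conv_sc (fun x => mine (u x) (v x))) x,
  Z (MkConv umax) x + Z (MkConv umin) x = Z u x + Z v x.

Definition epi_continuous := forall (u_ : nat -> Conv_sc R n) (u : Conv_sc R n),
  epi_cvg u_ u -> forall x, Z (u_ i) x @[i --> \oo] --> Z u x.

Definition SL_contravariant := forall (phi : 'M[R]_n) (phi1 : \det phi = 1)
  (u : Conv_sc R n) x, Z (comp_inv_conv phi1 u) x = Z u (phi^T *m x).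

Definition translation_conjugation := forall (u : Conv_sc R n) (y : 'cV[R]_n),
  (forall x, Z (translate_conv y u) x = Z u x + dotp x y) /\
  (forall x, Z (add_linear_conv y u) x = Z u (x - y)).

End Operators.

(* Main.v *)
Require Import Defs.
From mathcomp Require Import all_boot all_order all_algebra.
From mathcomp Require Import all_classical all_reals all_analysis.
From mathcomp Require Import ring lra.

Set Implicit Arguments.
Unset Strict Implicit.
Unset Printing Implicit Defensive.

Import Order.TTheory GRing.Theory Num.Theory.
Import numFieldNormedType.Exports.

(** Write [L u] for the Legendre transform of [u] with real values; its value at
    [x] is minus the minimum of [u - <x, .>], which is attained because [u] is
    lower semicontinuous and super-coercive. The transform satisfies the four
    properties: for continuity, minima of convex functions converge along
    epi-convergence to a coercive limit ([epi_cvg_min]); for the valuation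
    property, the only point is that [min (max u v) = max (min u) (min v)] when
    [min u v] is convex, which follows from the connectedness of a segment that
    joins the two minimizers ([is_min_max]).

    For the converse let [Z] have the four properties. Then [D = Z - L] has them
    too, except that the linear terms cancel: [d u = D u 0] is a continuous
    valuation which is invariant under SL(n), under translations of the
    argument and under addition of constants, and [D u x = d (u - <x, .>)]. So
    it is enough that such a [d] is constant ([invariant_valuation_const]). Let
    [c0] be its value at the indicator function of the origin.

    Flat domains ([flat_const]). If the domain of [u] lies in a hyperplane, a
    linear map of determinant 1 can shrink the hyperplane by an arbitrary factor
    and stretch a transversal direction. In the limit [u] becomes the indicator
    function of a point up to a constant, hence [d u = c0]. Consequently [d - c0]
    is additive when a domain is cut by a hyperplane.

    Affine functions on simplices ([gval_eq0]). Let [G (V; a)] be the value of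
    [d - c0] at the affine function with values [a] at the vertices of a simplex
    of signed volume [V]; by invariance only these data matter. Cutting an
    edge at its point of parameter [l] splits [G (V; a)] into a sum of two values
    with volumes [l V] and [(1 - l) V]. If two vertices carry equal values, a cut
    of their edge in the middle leaves [a] unchanged, so that [G (V; a)] is twice
    [G (V / 2; a)]. If three vertices carry values [a i < a k < a j], a cut of the
    edge from [i] to [j] at the level [a k] reduces to this case. Hence bisecting
    an edge writes [G (V; a)] as the mean of two values with the same [V], where one
    vertex value is replaced by a midpoint. Iterating, and using continuity at
    constant functions, [G (V; a) = G (V; 0)]. Finally let [a] be 0 at one vertex and tend
    to infinity at the others: the functions converge to the indicator of a
    vertex, so [G (V; a)] tends to 0, and [G] vanishes.

    Piecewise affine functions ([pwl_const]). A maximum of affine functions on a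
    simplex is treated by induction on their number: edge cuts at zeros of the
    difference of two of them lead to simplices where one of them is redundant.

    Density. Every [u] is a supremum of countably many affine functions, so
    finite maxima restricted to growing simplices epi-converge to [u]. *)

(** * Epi-convergence *)

Section EpiConvergence.
Local Open Scope classical_set_scope.
Local Open Scope ring_scope.
Context {R : realType} {n : nat}.
Implicit Types x y : 'cV[R]_n.

Lemma ereal_between (x y : \bar R) : (x < y)%E ->
  exists2 r : R, (x < r%:E)%E & (r%:E < y)%E.
Proof.
case: x => [x| |]; case: y => [y| |]//=.
- rewrite lte_fin => xy; exists ((x + y) / 2); rewrite lte_fin; lra.
- by exists (x + 1); rewrite ?ltry// lte_fin ltrDl.
- by exists (y - 1); rewrite ?ltNyr// lte_fin gtrBl.
- by exists 0; rewrite ?ltry ?ltNyr.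
Qed.

Lemma ge_of_lt_real (x y : \bar R) :
  (forall a : R, (a%:E < x)%E -> (a%:E <= y)%E) -> (x <= y)%E.
Proof.
move=> xy; rewrite leNgt; apply/negP => /ereal_between[r yr rx].
by have := lt_le_trans yr (xy _ rx); rewrite ltxx.
Qed.

Lemma cvge_from_bounds (v : nat -> \bar R) (l : \bar R) :
  (forall a : R, (a%:E < l)%E -> \forall i \near \oo, (a%:E < v i)%E) ->
  (forall b : R, (l < b%:E)%E -> \forall i \near \oo, (v i < b%:E)%E) ->
  v i @[i --> \oo] --> l.
Proof.
case: l => [l| |] lo up.
- apply/fine_cvgP; split.
    have la := lo (l - 1); have lb := up (l + 1).
    move: la lb; rewrite !lte_fin gtrBl ltrDl ltr01 => /(_ isT) la /(_ isT).
    apply: filterS2 la => i; by case: (v i).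
  apply/cvgrPdist_lt => e e0.
  have := up (l + e); have := lo (l - e); rewrite !lte_fin gtrBl ltrDl e0.
  move=> /(_ isT) la /(_ isT); apply: filterS2 la => i.
  rewrite /=; case: (v i) => [r| |]//=.
  by rewrite !lte_fin => lr rl; rewrite ltr_distlC lr.
- by apply/cvgeyPgt => A; apply: lo; rewrite ltry.
- by apply/cvgeNyPlt => A; apply: up; rewrite ltNyr.
Qed.

Lemma cvge_near_lt (v : nat -> \bar R) (l b : \bar R) :
  v i @[i --> \oo] --> l -> (l < b)%E -> \forall i \near \oo, (v i < b)%E.
Proof. by move=> vl lb; exact: (vl [set y | (y < b)%E] (open_ereal_lt' lb)). Qed.

Lemma lt_limn_einf (v : nat -> \bar R) (a : R) :
  (a%:E < limn_einf v)%E -> \forall i \near \oo, (a%:E < v i)%E.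
Proof.
move=> /ereal_between[b]; rewrite lte_fin limn_einf_lim => ab bv.
have := lte_lim (@nondecreasing_einfs _ v) (@is_cvg_einfs _ v) bv.
apply: filterS => i bi; apply: (@lt_le_trans _ _ b%:E); rewrite ?lte_fin//.
apply: le_trans bi _; apply: ereal_inf_lbound; by exists i => /=.
Qed.

Lemma limn_einf_ge (v : nat -> \bar R) (a : \bar R) :
  (\forall i \near \oo, (a <= v i)%E) -> (a <= limn_einf v)%E.
Proof.
move=> [N _ Nv]; rewrite limn_einf_lim.
apply: lime_ge; first exact: is_cvg_einfs.
exists N => // i Ni; apply: le_ereal_inf_tmp => _ [k /= ik <-].
by apply: Nv => /=; exact: leq_trans Ni ik.
Qed.

(** The lower bound of epi-convergence without sequences: a strict lower bound
    of the limit at a point holds uniformly in a neighborhood, for all large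
    indices. In this form it can be combined with compactness. *)
Definition epi_liminf (u_ : nat -> 'cV[R]_n -> \bar R) (u : 'cV[R]_n -> \bar R) := forall x (a : R),
  (a%:E < u x)%E -> \forall y \near x & i \near \oo, (a%:E < u_ i y)%E.

Lemma epi_cvg_intro (u_ : nat -> 'cV[R]_n -> \bar R) u : epi_liminf u_ u ->
  (forall x, exists2 x_ : nat -> 'cV[R]_n, x_ @ \oo --> x &
     u_ i (x_ i) @[i --> \oo] --> u x) -> epi_cvg u_ u.
Proof.
move=> lu rec x; split; last exact: rec.
move=> x_ xx; apply: ge_of_lt_real => a /lu au.
apply: limn_einf_ge.
have [[A B] /= [xA [N _ NB]] AB] := au.
have [M _ MA] := xx _ xA; exists (maxn N M) => // i /=; rewrite geq_max => /andP[Ni Mi].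
by apply/ltW/(AB (x_ i, i)); split; [exact: MA|exact: NB].
Qed.

(** If the uniform bound fails at [x], then infinitely many [u_ i] take a value
    at most [a] at points closer and closer to [x]; interspersing copies of [x]
    gives a sequence that converges to [x] and violates the sequential bound. *)
Lemma epi_cvg_liminf (u_ : nat -> 'cV[R]_n -> \bar R) u : epi_cvg u_ u -> epi_liminf u_ u.
Proof.
move=> uu x a ax; apply: contrapT => nea.
pose hit k i := exists2 y, ball x (k.+1%:R^-1) y & (u_ i y <= a%:E)%E.
have hitP k N : exists2 i, (N <= i)%N & hit k i.
  apply: contrapT => nohit; apply: nea.
  exists (ball x (k.+1%:R^-1), [set i | (N <= i)%N]).
    by split; [apply: nbhsx_ballx; rewrite invr_gt0|exists N].
  move=> [y i] [/= xy Ni]; rewrite ltNge; apply/negP => uya; apply: nohit.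
  by exists i => //; exists y.
(* [c i] counts the indices before [i] at which a bad point was taken; a bad
   point for [i] must be within [1 / (c i + 1)] of [x]. *)
pose fix c i := if i is j.+1 then (c j + `[< hit (c j) j >])%N else 0%N.
have c_nd : {homo c : i j / (i <= j)%N}.
  by apply: homo_leq => // [? ? ?|i]; [exact: leq_trans|exact: leq_addr].
have often N : exists2 i, (N <= i)%N & hit (c i) i.
  apply: contrapT => no.
  have cN i : (N <= i)%N -> c i = c N.
    elim: i => [|i IH]; first by rewrite leqn0 => /eqP ->.
    rewrite leq_eqVlt => /predU1P[->//|]; rewrite ltnS => Ni /=.
    rewrite IH//; case: asboolP => /=; rewrite ?addn0// => h.
    by exfalso; apply: no; exists i => //; rewrite IH.
  have [i Ni hi] := hitP (c N) N; by apply: no; exists i => //; rewrite cN.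
have c_oo k : exists N, (k <= c N)%N.
  elim: k => [|k [N kN]]; first by exists 0%N.
  have [i Ni hi] := often N; exists i.+1 => /=.
  by rewrite asboolT// addn1 ltnS (leq_trans kN)// c_nd.
pose x_ i := match pselect (hit (c i) i) with
  | left h => sval (cid2 h) | right _ => x end.
have x_P i : ball x ((c i).+1%:R^-1) (x_ i).
  rewrite /x_; case: pselect => h; last by apply: ballxx; rewrite invr_gt0.
  by case: cid2.
have x_cvg : x_ @ \oo --> x.
  apply/cvg_ballP => e e0.
  have [k _ ke] := near_infty_natSinv_lt (PosNum e0).
  have [N kN] := c_oo k; exists N => // i /= Ni.
  apply: le_ball (x_P i); apply/ltW/ke => /=.
  exact: leq_trans kN (c_nd _ _ Ni).
have [lu _] := uu x.
have [N _ Nlu] := lt_limn_einf (lt_le_trans ax (lu _ x_cvg)).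
have [i Ni hi] := often N.
have := Nlu i Ni; rewrite /x_; case: pselect => // h.
by case: cid2 => y /= _ uy; rewrite ltNge uy.
Qed.

End EpiConvergence.

(** * Minima of coercive functions *)

Section Minimum.
Local Open Scope classical_set_scope.
Local Open Scope ring_scope.
Context {R : realType} {n : nat}.
Implicit Types (x y : 'cV[R]_n) (u v : 'cV[R]_n -> \bar R).

Lemma coord_le_norm x i : `|x i 0| <= `|x|.
Proof.
rewrite [leRHS]/Num.norm/= mx_normrE.
by apply/bigmax_geP; right; exists (i, 0).
Qed.

Lemma norm_le_coord x (r : R) : 0 <= r -> (forall i, `|x i 0| <= r) -> `|x| <= r.
Proof.
move=> r0 xr; rewrite [leLHS]/Num.norm/= mx_normrE.
by apply/bigmax_leP; split=> // -[i j] _ /=; rewrite (ord1 j).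
Qed.

Lemma norm_le_l1 x : `|x| <= l1norm x.
Proof. by apply: norm_le_coord => [|i]; rewrite ?l1norm_ge0// coord_l1. Qed.

Lemma l1_le_norm x : l1norm x <= n%:R * `|x|.
Proof.
rewrite mulr_natl -[X in _ <= _ *+ X](card_ord n) -sumr_const.
by apply: ler_sum => i _; exact: coord_le_norm.
Qed.

Lemma cV_bounded_closed_compact (A : set 'cV[R]_n) (r : R) :
  closed A -> (forall x, A x -> `|x| <= r) -> compact A.
Proof.
move=> cA Ar.
have tr_cont m p : continuous (@trmx R m p).
  move=> z B [P Pz PB]; exists (fun i j => P j i) => [i j|w Pw].
    by have := Pz j i; rewrite mxE.
  by apply: PB => i j; rewrite mxE.
have -> : A = trmx @` [set z : 'rV[R]_n | A z^T].
  apply/seteqP; split=> [x Ax|_ [z Az <-]//].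
  by exists x^T => /=; rewrite trmxK.
apply: continuous_compact; first exact/continuous_subspaceT/tr_cont.
apply: bounded_closed_compact.
  exists r; split; first exact: num_real.
  move=> M rM z /= /Ar zr; rewrite [leLHS]/Num.norm/= mx_normrE.
  apply/bigmax_leP; split=> [|[i j] _ /=].
    by apply: le_trans (ltW rM); apply: le_trans zr.
  rewrite (ord1 i); apply: le_trans (ltW rM); apply: le_trans zr.
  by apply: le_trans (coord_le_norm _ j); rewrite mxE.
by apply: (@preimage_closed _ _ trmx) => // z _; exact: tr_cont.
Qed.

Lemma subr_continuous (p : 'cV[R]_n) : continuous (fun x : 'cV[R]_n => x - p).
Proof.
move=> x; apply: (@continuousB _ _ _ id (cst p)); first exact: cvg_id.
exact: cst_continuous.
Qed.

Lemma closed_fun_le (T : topologicalType) (f : T -> R) (a : R) :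
  continuous f -> closed [set x | f x <= a].
Proof.
move=> fc; apply: (preimage_closed (f := f) (D := [set y | y <= a])).
  by move=> x _; exact: fc.
exact: closed_le.
Qed.

Lemma closed_fun_ge (T : topologicalType) (f : T -> R) (a : R) :
  continuous f -> closed [set x | a <= f x].
Proof.
move=> fc; apply: (preimage_closed (f := f) (D := [set y | a <= y])).
  by move=> x _; exact: fc.
exact: closed_ge.
Qed.

Definition coercive (u : 'cV[R]_n -> \bar R) :=
  forall M : R, exists r : R, forall x, r < `|x| -> (M%:E <= u x)%E.

Definition is_min (u : 'cV[R]_n -> \bar R) (r : R) :=
  (exists p, u p = r%:E) /\ forall y, (r%:E <= u y)%E.

Lemma is_min_uniq u (r s : R) : is_min u r -> is_min u s -> r = s.
Proof.
move=> [[p up] ur] [[q uq] us]; apply/eqP; rewrite eq_le.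
by have := ur q; have := us p; rewrite up uq !lee_fin => -> ->.
Qed.

Lemma proper_fin u : (forall x, u x != -oo%E) -> Defs.proper u ->
  exists (x : 'cV[R]_n) (r : R), u x = r%:E.
Proof. by move=> uNy [x]; have := uNy x; case E: (u x) => [r| |]//; exists x, r. Qed.

(** If no point were a minimizer, every point [x] would have a neighborhood on
    which [u] exceeds some value [u y]. By compactness one value of [u] would be
    smaller than all values on a set that contains every small value of [u]. *)
Lemma coercive_min (u : 'cV[R]_n -> \bar R) : (forall x, u x != -oo%E) ->
  lower_semicontinuous u -> Defs.proper u -> coercive u -> exists r, is_min u r.
Proof.
move=> uNy lu pu cu.
have [x0 [r0 ux0]] := proper_fin uNy pu.
have [r ru] := cu (r0 + 1).
pose K := [set x : 'cV[R]_n | `|x| <= Num.max r `|x0|].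
have cK : compact K.
  apply: (@cV_bounded_closed_compact K (Num.max r `|x0|)) => //.
  exact/closed_fun_le/norm_continuous.
have uK x : (u x <= u x0)%E -> K x.
  move=> ux; rewrite /K/= leNgt; apply/negP; rewrite gt_max => /andP[rx _].
  have := le_trans (ru x rx) ux; rewrite ux0 lee_fin; lra.
suff [p pmin] : exists p, forall y, (u p <= u y)%E.
  have : (u p <= r0%:E)%E by rewrite -ux0.
  case E: (u p) => [s| |]// _.
    by exists s; split; [exists p|move=> y; rewrite -E].
  by have := uNy p; rewrite E.
apply: contrapT => nomin.
pose F := filter_from [set: 'cV[R]_n] (fun y => [set z | (u z <= u y)%E]).
have FF : Filter F.
  apply: filter_from_filter; first by exists 0.
  move=> y z _ _; case: (leP (u y) (u z)) => yz.
    by exists y => // w /= wy; split=> //=; exact: le_trans yz.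
  by exists z => // w /= wy; split=> //=; apply: le_trans (ltW yz).
have := (compact_near_coveringP K).1 cK _ F (fun z x => (u z < u x)%E) FF.
case=> [x Kx|y _ /= yK].
  have [y uyx] : exists y, (u y < u x)%E.
    apply: contrapT => no; apply: nomin; exists x => y.
    by rewrite leNgt; apply/negP => uyx; apply: no; exists y.
  have [a ya /lu[V Vx Vu]] := ereal_between uyx.
  exists (V, [set z | (u z <= u y)%E]); first by split=> //; exists y.
  by move=> [x' z] /= [/Vu ax' zy]; apply: le_lt_trans zy (lt_trans ya ax').
have [z zy zx0] : exists2 z, (u z <= u y)%E & (u z <= u x0)%E.
  by case: (leP (u y) (u x0)) => h; [exists y|exists x0 => //; exact: ltW].
by have := yK z zy z (uK _ zx0); rewrite ltxx.
Qed.

Lemma supercoercive_coercive u : supercoercive u -> coercive u.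
Proof.
move=> /supercoercive_l1 su M; have [r ru] := su `|M|.
exists (Num.max r 1) => x; rewrite gt_max => /andP[rx x1].
apply: le_trans (ru x (lt_le_trans rx (norm_le_l1 x))).
rewrite lee_fin; apply: le_trans (ler_norm M) _.
by rewrite ler_peMr// (le_trans (ltW x1))// norm_le_l1.
Qed.

Lemma conv_sc_min u : conv_sc u -> exists r, is_min u r.
Proof. by case=> ? ? _ ? /supercoercive_coercive; exact: coercive_min. Qed.

Lemma closed_sublevel u (a : R) : lower_semicontinuous u ->
  closed [set x : 'cV[R]_n | (u x <= a%:E)%E].
Proof.
move=> lu; rewrite -openC.
have -> : ~` [set x | (u x <= a%:E)%E] = [set x | (a%:E < u x)%E].
  by apply/seteqP; split=> x /=; rewrite ltNge => /negP.
exact: (lower_semicontinuousP u).1 lu a.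
Qed.

Lemma is_min_min u v (r s : R) :
  is_min u r -> is_min v s -> is_min (fun x => mine (u x) (v x)) (Num.min r s).
Proof.
move=> [[p up] ur] [[q vq] vs]; split.
  have [rs|sr] := leP r s.
    by exists p; rewrite up; apply/min_idPl; rewrite (le_trans _ (vs p))// lee_fin.
  exists q; rewrite vq; apply/min_idPr; rewrite (le_trans _ (ur q))// lee_fin.
  exact: ltW.
move=> y; rewrite le_min EFin_min !ge_min ur vs; by rewrite orbT.
Qed.

(** On the segment between the two minimizers, the closed sets where [u] and
    where [v] are at most [M] are nonempty, and they cover the segment because
    [min u v] is convex; the segment being connected, they meet. *)
Lemma is_min_max u v (r s : R) : lower_semicontinuous u ->
  lower_semicontinuous v -> econvex (fun x => mine (u x) (v x)) ->
  is_min u r -> is_min v s -> is_min (fun x => maxe (u x) (v x)) (Num.max r s).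
Proof.
move=> lu lv cuv [[p up] ur] [[q vq] vs]; set M := Num.max r s.
suff [z uz vz] : exists2 z, (u z <= M%:E)%E & (v z <= M%:E)%E.
  have lb y : (M%:E <= maxe (u y) (v y))%E.
    by rewrite EFin_max ge_max !le_max ur vs orbT.
  by split=> //; exists z; apply/eqP; rewrite eq_le lb ge_max uz vz.
pose z (t : R) : 'cV[R]_n := t *: p + (1 - t) *: q.
have zc : continuous z.
  move=> t; apply: cvgD; apply: cvgZr_tmp; first exact: cvg_id.
  by apply: cvgB; [exact: cvg_cst|exact: cvg_id].
have cl w : lower_semicontinuous w -> closed [set t | (w (z t) <= M%:E)%E].
  move=> lw; apply: (preimage_closed (f := z) (D := [set x | (w x <= M%:E)%E])).
    by move=> t _; exact: zc.
  exact: closed_sublevel.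
have cov t : 0 <= t <= 1 -> (u (z t) <= M%:E)%E \/ (v (z t) <= M%:E)%E.
  move=> t01; apply/orP; rewrite -ge_min.
  apply: le_trans (cuv _ _ _ t01) _.
  have t0 : 0 <= t by case/andP: t01.
  have t1 : 0 <= 1 - t by rewrite subr_ge0; case/andP: t01.
  have -> : M = t * M + (1 - t) * M by ring.
  rewrite [leRHS]EFinD [X in (_ <= X + _)%E]EFinM [X in (_ <= _ + X)%E]EFinM.
  apply: leeD; apply: lee_wpmul2l; rewrite ?lee_fin//.
    by rewrite ge_min up lee_fin /M le_max lexx.
  by rewrite ge_min vq lee_fin /M le_max lexx !orbT.
have p1 : (u (z 1%R) <= M%:E)%E.
  by rewrite /z subrr scale0r addr0 scale1r up lee_fin /M le_max lexx.
have q0 : (v (z 0%R) <= M%:E)%E.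
  by rewrite /z subr0 scale0r add0r scale1r vq lee_fin /M le_max lexx orbT.
apply: contrapT => no.
have no' t : (u (z t) <= M%:E)%E -> (v (z t) <= M%:E)%E -> False.
  by move=> ut vt; apply: no; exists (z t).
suff : `[0, 1]%classic `&` [set t | (u (z t) <= M%:E)%E] = `[0, 1]%classic.
  move=> /seteqP[_ /(_ 0)]; rewrite /= in_itv/= lexx ler01 => /(_ isT)[_ u0].
  exact: no' u0 q0.
apply: (@segment_connected R 0 1).
- by exists 1; split=> //=; rewrite in_itv/= lexx ler01.
- exists (~` [set t | (v (z t) <= M%:E)%E]); first by rewrite openC; exact: cl.
  apply/seteqP; split=> t /= [t01 ut]; split=> //; first exact: no' ut.
  by move: t01; rewrite in_itv/= => /cov[].
- by exists [set t | (u (z t) <= M%:E)%E] => //; exact: cl.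
Qed.

(** Near the minimizer [p] of [u], compactness gives [u_ i > r - e]. Minimizers of
    [u_ i] cannot escape: on a thick sphere around [p] one has [u_ i > r + 1],
    while [u_ i] is less than [r + 1] at some point near [p], so that by
    convexity it stays above [r + 1] outside the sphere. *)
Lemma epi_cvg_min (u_ : nat -> 'cV[R]_n -> \bar R) u (r_ : nat -> R) r :
  epi_cvg u_ u -> (forall i, econvex (u_ i)) -> coercive u ->
  (forall i, is_min (u_ i) (r_ i)) -> is_min u r -> r_ i @[i --> \oo] --> r.
Proof.
move=> uu cu_ cu rmin_ [[p up] ur].
have lu := epi_cvg_liminf uu.
have [_ [p_ pp]] := uu p; rewrite up => upp.
have [R0 R0u] := cu (r + 2).
pose rho : R := `|R0| + `|p| + 1.
have rho0 : 0 < rho by rewrite /rho ltr_pwDr// addr_ge0.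
have far z : rho <= `|z - p| -> ((r + 1)%:E < u z)%E.
  move=> zp; apply: (@lt_le_trans _ _ (r + 2)%:E); first by rewrite lte_fin ltrD2l ltr1n.
  apply: R0u; have := ler_norm R0; have := ler_normB z p; rewrite /rho in zp.
  lra.
have bc (a b : R) : compact [set z : 'cV[R]_n | a <= `|z - p| <= b].
  have nc : continuous (fun z : 'cV[R]_n => `|z - p|).
    move=> z; have nz := @norm_continuous R 'cV[R]_n (z - p).
    exact: continuous_comp (@subr_continuous p z) nz.
  apply: (@cV_bounded_closed_compact _ (b + `|p|)).
    rewrite (_ : [set z | _] = [set z | a <= `|z - p|] `&` [set z | `|z - p| <= b]).
      by apply: closedI; [exact: closed_fun_ge|exact: closed_fun_le].
    by apply/seteqP; split=> z /= => [/andP|] [-> ->].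
  move=> z /= /andP[_ zb]; have := ler_normD (z - p) p; rewrite subrK; lra.
apply/cvgrPdist_lt => e e0.
have K1 : \forall i \near \oo, [set z | 0 <= `|z - p| <= 3 * rho] `<=`
    [set z | ((r - e)%:E < u_ i z)%E].
  apply: (compact_near_coveringP _).1 => [//|x _]; apply: lu.
  by apply: lt_le_trans (ur x); rewrite lte_fin gtrBl.
have K2 : \forall i \near \oo, [set z | rho <= `|z - p| <= 3 * rho] `<=`
    [set z | ((r + 1)%:E < u_ i z)%E].
  apply: (compact_near_coveringP _).1 => [//|x /= /andP[xp _]]; exact/lu/far.
have near_p : \forall i \near \oo, `|p - p_ i| < rho.
  by move/cvgrPdist_lt : pp; exact.
have val_p : \forall i \near \oo, (u_ i (p_ i) < (r + Num.min e 1)%:E)%E.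
  by apply: (cvge_near_lt upp); rewrite lte_fin ltrDl lt_min e0 ltr01.
near=> i.
have k1 : [set z | 0 <= `|z - p| <= 3 * rho] `<=`
    [set z | ((r - e)%:E < u_ i z)%E] by near: i.
have k2 : [set z | rho <= `|z - p| <= 3 * rho] `<=`
    [set z | ((r + 1)%:E < u_ i z)%E] by near: i.
have np : `|p - p_ i| < rho by near: i.
have np' : `|p_ i - p| < rho by rewrite distrC.
have vp : (u_ i (p_ i) < (r + Num.min e 1)%:E)%E by near: i.
have [[q uq] rq] := rmin_ i.
have [s us] : exists s, u_ i (p_ i) = s%:E.
  by have := rq (p_ i); move: vp; case: (u_ i (p_ i)) => // s _ _; exists s.
have := rq (p_ i); rewrite us lee_fin => rs.
move: vp; rewrite us lte_fin -ltrBlDl lt_min => /andP[se s1].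
have [qp|qp] := leP `|q - p| (3 * rho).
  have : ((r - e)%:E < u_ i q)%E by apply: k1; rewrite /= qp normr_ge0.
  by rewrite uq lte_fin distrC ltr_distlC; lra.
exfalso.
have D0 : 2 * rho < `|q - p_ i|.
  have := ler_normD (q - p_ i) (p_ i - p); rewrite addrA subrK; lra.
pose t := 2 * rho / `|q - p_ i|.
have t0 : 0 <= t by rewrite /t divr_ge0//; lra.
have t1 : t <= 1 by rewrite /t ler_pdivrMr; lra.
pose z := t *: q + (1 - t) *: p_ i.
have zp : z - p_ i = t *: (q - p_ i).
  by rewrite /z scalerBl scale1r scalerBr; rewrite addrA addrAC addrK.
have nz : `|z - p_ i| = 2 * rho.
  by rewrite zp normrZ ger0_norm// /t divfK//; apply/eqP; lra.
have : ((r + 1)%:E < u_ i z)%E.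
  apply: k2; apply/andP; split.
    have := ler_normD (z - p) (p - p_ i); rewrite addrA subrK nz; lra.
  have := ler_normD (z - p_ i) (p_ i - p); rewrite addrA subrK nz; lra.
rewrite ltNge => /negP; apply.
apply: le_trans (cu_ i q (p_ i) t _) _; first by rewrite t0 t1.
rewrite us uq -!EFinM -EFinD lee_fin.
have : t * r_ i <= t * s by exact: ler_wpM2l.
lra.
Unshelve. all: by end_near. Qed.

End Minimum.

(** * The Legendre transform satisfies the four properties *)

Section Fenchel.
Local Open Scope classical_set_scope.
Local Open Scope ring_scope.
Context {R : realType} {n : nat}.
Implicit Types (x y : 'cV[R]_n) (u v : 'cV[R]_n -> \bar R).

Lemma dotpC x y : dotp x y = dotp y x.
Proof. by apply: eq_bigr => i _; rewrite mulrC. Qed.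

Lemma dotpDr x y z : dotp x (y + z) = dotp x y + dotp x z.
Proof. by rewrite dotpC dotpDl !(dotpC x). Qed.

Lemma dotpZr a x z : dotp x (a *: z) = a * dotp x z.
Proof. by rewrite dotpC dotpZl dotpC. Qed.

Lemma dotpNr x y : dotp x (- y) = - dotp x y.
Proof. by rewrite -scaleN1r dotpZr mulN1r. Qed.

Lemma dotpNl x y : dotp (- x) y = - dotp x y.
Proof. by rewrite dotpC dotpNr dotpC. Qed.

Lemma dotp_mulmx (A : 'M[R]_n) x y : dotp (A *m x) y = dotp x (A^T *m y).
Proof.
have dE z w : dotp z w = (z^T *m w) 0 0.
  by rewrite mxE; apply: eq_bigr => i _; rewrite mxE.
by rewrite !dE trmx_mul mulmxA.
Qed.

Lemma is_min_translate u r y : is_min u r -> is_min (translate y u) r.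
Proof.
move=> [[p up] ur]; split; last by move=> x; exact: ur.
by exists (p + y); rewrite /translate addrK.
Qed.

Lemma is_min_addr u r (c : R) : is_min u r -> is_min (fun x => (u x + c%:E)%E) (r + c).
Proof.
move=> [[p up] ur]; split; first by exists p; rewrite up.
by move=> x; rewrite EFinD leeD2r.
Qed.

Lemma is_min_comp_inv u r (phi : 'M[R]_n) : phi \in unitmx ->
  is_min u r -> is_min (comp_inv phi u) r.
Proof.
move=> phiU [[p up] ur]; split; last by move=> x; exact: ur.
by exists (phi *m p); rewrite /comp_inv mulKmx.
Qed.

Definition minval u : R := xget 0 [set r | is_min u r].

Lemma minvalP u : conv_sc u -> is_min u (minval u).
Proof. by move=> /conv_sc_min[r ur]; exact: (@xgetI _ 0 [set r | is_min u r] r). Qed.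

Lemma minval_eq u r : is_min u r -> minval u = r.
Proof.
by move=> ur; apply: (is_min_uniq _ ur); exact: (@xgetI _ 0 [set r | is_min u r] r).
Qed.

Definition fenchel u x : R := - minval (add_linear (- x) u).

Lemma fenchelP u x : conv_sc u -> is_min (add_linear (- x) u) (- fenchel u x).
Proof. by move=> cu; rewrite opprK; apply: minvalP; exact: conv_sc_add_linear. Qed.

Lemma fenchel_eq u x r : is_min (add_linear (- x) u) (- r) -> fenchel u x = r.
Proof. by rewrite /fenchel => /minval_eq ->; rewrite opprK. Qed.

Lemma legendre_fenchel u x : conv_sc u -> legendre u x = (fenchel u x)%:E.
Proof.
move=> cu; have [[p up] ur] := fenchelP x cu.
have E y : ((dotp x y)%:E - u y = - add_linear (- x) u y)%E.
  rewrite /add_linear dotpNr (dotpC x).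
  by case: (u y) => //= s; congr EFin; ring.
apply/eqP; rewrite eq_le; apply/andP; split.
  apply: ge_ereal_sup => _ [y _ <-]; rewrite E leeNl -EFinN; exact: ur.
apply: ereal_sup_ubound; exists p => //.
by rewrite E up -EFinN opprK.
Qed.

Lemma fenchel_translate u y x : conv_sc u ->
  fenchel (translate y u) x = fenchel u x + dotp x y.
Proof.
move=> cu; apply: fenchel_eq; rewrite opprD.
have -> : add_linear (- x) (translate y u) =
    fun z => (translate y (add_linear (- x) u) z + (- dotp x y)%:E)%E.
  apply/funext => z; rewrite /add_linear /translate -addeA -EFinD.
  congr (_ + _%:E)%E; rewrite dotpDl dotpNl !dotpNr (dotpC y); ring.
exact/is_min_addr/is_min_translate/fenchelP.
Qed.

Lemma add_linearD u x y : add_linear x (add_linear y u) = add_linear (x + y) u.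
Proof.
apply/funext => z; rewrite /add_linear -addeA -EFinD dotpDr.
by congr (_ + _%:E)%E; rewrite addrC.
Qed.

Lemma exists_unit_vector : (0 < n)%N -> exists z : 'cV[R]_n, dotp z z = 1.
Proof.
move=> n0; exists (delta_mx (Ordinal n0) 0).
rewrite /dotp (bigD1 (Ordinal n0))//= big1 ?addr0 ?mxE ?eqxx ?mulr1// => i ni.
by rewrite mxE (negbTE ni) mul0r.
Qed.

(** Translations and additions of linear functions commute only up to a
    constant, so they generate the additions of constants. *)
Lemma addr_translate_linear u y z : (fun x => u x + (- dotp z y)%:E)%E =
  translate y (add_linear z (translate (- y) (add_linear (- z) u))).
Proof.
apply/funext => x; rewrite /translate /add_linear opprK subrK -addeA -EFinD.
by congr (_ + _%:E)%E; rewrite dotpNr dotpDl dotpNl (dotpC z); ring.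
Qed.

Lemma fenchel_add_linear u y x : fenchel (add_linear y u) x = fenchel u (x - y).
Proof. by rewrite /fenchel add_linearD opprB addrC. Qed.

Lemma fenchel_comp_inv u (phi : 'M[R]_n) x : \det phi = 1 -> conv_sc u ->
  fenchel (comp_inv phi u) x = fenchel u (phi^T *m x).
Proof.
move=> phi1 cu; apply: fenchel_eq.
have phiU : phi \in unitmx by rewrite unitmxE phi1 unitr1.
have -> : add_linear (- x) (comp_inv phi u) =
    comp_inv phi (add_linear (- (phi^T *m x)) u).
  apply/funext => z; rewrite /add_linear /comp_inv.
  by rewrite -mulmxN -dotp_mulmx mulKVmx.
exact/is_min_comp_inv/fenchelP.
Qed.

Lemma lsc_conv u : conv_sc u -> lower_semicontinuous u. Proof. by case. Qed.

Lemma fenchel_valuation u v x : conv_sc u -> conv_sc v ->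
  conv_sc (fun x => mine (u x) (v x)) ->
  fenchel (fun x => maxe (u x) (v x)) x + fenchel (fun x => mine (u x) (v x)) x =
  fenchel u x + fenchel v x.
Proof.
move=> cu cv cm; have fu := fenchelP x cu; have fv := fenchelP x cv.
have Emax : add_linear (- x) (fun x => maxe (u x) (v x)) =
    fun y => maxe (add_linear (- x) u y) (add_linear (- x) v y).
  by apply/funext => y; exact: adde_maxl.
have Emin : add_linear (- x) (fun x => mine (u x) (v x)) =
    fun y => mine (add_linear (- x) u y) (add_linear (- x) v y).
  apply/funext => y; rewrite /add_linear.
  have [uv|vu] := leP (u y) (v y).
    by apply/esym/min_idPl; rewrite leeD2rE.
  by apply/esym/min_idPr; rewrite leeD2rE// ltW.
have := is_min_min fu fv; rewrite -Emin -oppr_max => /fenchel_eq ->.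
have := is_min_max _ _ _ fu fv; rewrite -Emax -Emin -oppr_min => /(_ _ _ _)/fenchel_eq ->.
- rewrite addrC; exact: addr_max_min.
- exact/lsc_conv/conv_sc_add_linear.
- exact/lsc_conv/conv_sc_add_linear.
- by case: (conv_sc_add_linear (- x) cm).
Qed.

Lemma epi_cvg_add_linear (u_ : nat -> 'cV[R]_n -> \bar R) u y :
  epi_cvg u_ u -> epi_cvg (fun i => add_linear y (u_ i)) (add_linear y u).
Proof.
move=> uu; apply: epi_cvg_intro => x.
  move=> a; rewrite /add_linear -lteBlDr// -EFinB => /ereal_between[b].
  rewrite lte_fin => ab /(epi_cvg_liminf uu)[[V W] /= [Vx Woo] VW].
  exists (V `&` [set z | a - b < dotp z y], W).
    split=> //=; apply: filterI => //.
    apply: (@dotp_continuous _ _ y x [set t | a - b < t]).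
    by apply: open_nbhs_nbhs; split; [exact: open_gt|rewrite /=; lra].
  move=> [z i] [/= [Vz az] Wi]; rewrite -lteBlDr// -EFinB.
  by apply: lt_trans (VW (z, i) _) => //; rewrite lte_fin; lra.
have [_ [x_ xx ux]] := uu x; exists x_ => //.
apply: cvgeD => //; first exact: fin_num_adde_defl.
apply: cvg_EFin; first exact: nearW.
have h := @dotp_continuous _ _ y x.
have := @cvg_comp _ _ _ x_ (fun z => dotp z y) _ _ _ xx h.
exact.
Qed.

Lemma fenchel_epi_cvg (u_ : nat -> 'cV[R]_n -> \bar R) u x :
  (forall i, conv_sc (u_ i)) -> conv_sc u -> epi_cvg u_ u ->
  fenchel (u_ i) x @[i --> \oo] --> fenchel u x.
Proof.
move=> cu_ cu uu.
have := @epi_cvg_min _ _ _ _ (fun i => - fenchel (u_ i) x) (- fenchel u x)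
  (epi_cvg_add_linear (- x) uu).
have H : - - fenchel u x = fenchel u x by rewrite opprK.
move=> h; rewrite -H.
have -> : (fun i => fenchel (u_ i) x) = fun i => - - fenchel (u_ i) x.
  by apply/funext => i; rewrite opprK.
apply: cvgN; apply: h.
- by move=> i; case: (conv_sc_add_linear (- x) (cu_ i)).
- by apply: supercoercive_coercive; case: (conv_sc_add_linear (- x) cu).
- by move=> i; exact: fenchelP.
- exact: fenchelP.
Qed.

End Fenchel.

(** * Convex functions restricted to bounded convex sets *)

Section Restriction.
Local Open Scope classical_set_scope.
Local Open Scope ring_scope.
Context {R : realType} {n : nat}.
Implicit Types (x y : 'cV[R]_n) (u w : 'cV[R]_n -> \bar R) (C : set 'cV[R]_n)
  (v : 'cV[R]_n -> R).

Definition restrict C v x : \bar R := if `[< C x >] then (v x)%:E else +oo%E.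

Lemma restrictT C v x : C x -> restrict C v x = (v x)%:E.
Proof. by move=> Cx; rewrite /restrict asboolT. Qed.

Lemma restrictF C v x : ~ C x -> restrict C v x = +oo%E.
Proof. by move=> Cx; rewrite /restrict asboolF. Qed.

Lemma restrict_le (C D : set 'cV[R]_n) (v1 v2 : 'cV[R]_n -> R) x :
  (D x -> C x) -> (D x -> v1 x <= v2 x) -> (restrict C v1 x <= restrict D v2 x)%E.
Proof.
move=> DC vw; rewrite {2}/restrict; case: asboolP => Dx; last by rewrite leey.
by rewrite restrictT ?lee_fin; auto.
Qed.

Definition convex_fun v := forall x y (t : R), 0 <= t <= 1 ->
  v (t *: x + (1 - t) *: y) <= t * v x + (1 - t) * v y.

Definition cvx_set C := forall x y (t : R), 0 <= t <= 1 -> C x -> C y ->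
  C (t *: x + (1 - t) *: y).

Lemma econvex_restrict C v : cvx_set C -> convex_fun v -> econvex (restrict C v).
Proof.
move=> cC cv x y t t01.
have [Cx|Cx] := pselect (C x); have [Cy|Cy] := pselect (C y).
- rewrite !restrictT//; last exact: cC.
  by rewrite -!EFinM -EFinD lee_fin cv.
- rewrite (restrictT _ Cx) (restrictF _ Cy).
  have [t1|t1] := eqVneq t 1.
    by rewrite t1 subrr mul0e adde0 scale0r addr0 scale1r mul1e restrictT.
  rewrite gt0_muley ?addey ?leey// lte_fin subr_gt0 lt_neqAle t1.
  by case/andP: t01.
- rewrite (restrictF _ Cx) (restrictT _ Cy).
  have [t0|t0] := eqVneq t 0.
    by rewrite t0 subr0 mul0e add0e scale0r add0r scale1r mul1e restrictT.
  rewrite gt0_muley ?addye ?leey// lte_fin lt_neqAle eq_sym t0.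
  by case/andP: t01.
- case/andP: t01 => t0 t1; rewrite (restrictF _ Cx) (restrictF _ Cy).
  rewrite -ge0_muleDl ?lee_fin ?subr_ge0// -EFinD addrCA subrr addr0 mul1e.
  exact: leey.
Qed.

Lemma lsc_restrict C v : closed C -> continuous v -> lower_semicontinuous (restrict C v).
Proof.
move=> cC cv x a; have [Cx|Cx] := pselect (C x).
  rewrite restrictT// lte_fin => avx; exists [set y | a < v y].
    apply: (cv x [set t | a < t]).
    by apply: open_nbhs_nbhs; split; [exact: open_gt|].
  by move=> y /= avy; rewrite /restrict; case: asboolP; rewrite ?lte_fin ?ltry.
move=> _; exists (~` C); first by apply: open_nbhs_nbhs; split; rewrite ?openC.
by move=> y Cy; rewrite restrictF ?ltry.
Qed.

Lemma conv_sc_restrict C v (r : R) : closed C -> cvx_set C ->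
  (forall x, C x -> `|x| <= r) -> C !=set0 -> continuous v -> convex_fun v ->
  conv_sc (restrict C v).
Proof.
move=> clC cC Cr [x0 Cx0] cv vv; split.
- by move=> x; rewrite /restrict; case: ifP.
- exact: lsc_restrict.
- exact: econvex_restrict.
- by exists x0; rewrite restrictT.
- apply/supercoercive_l1 => M; exists (n%:R * r) => x rx.
  rewrite restrictF ?leey// => /Cr xr.
  have := lt_le_trans rx (l1_le_norm x); rewrite ltNge => /negP; apply.
  exact: ler_wpM2l.
Qed.

Lemma conv_sc_addr u (c : R) : (0 < n)%N -> conv_sc u ->
  conv_sc (fun x => (u x + c%:E)%E).
Proof.
move=> n0 cu; have [z zz] := @exists_unit_vector R n n0.
have -> : c = - dotp z (- c *: z) by rewrite dotpZr zz mulr1 opprK.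
rewrite addr_translate_linear.
by do 2 (apply: conv_sc_translate; apply: conv_sc_add_linear).
Qed.

Lemma epi_cvg_pointwise (u_ : nat -> 'cV[R]_n -> \bar R) u : epi_liminf u_ u ->
  (forall x (b : R), (u x < b%:E)%E -> \forall i \near \oo, (u_ i x < b%:E)%E) ->
  epi_cvg u_ u.
Proof.
move=> lu up; apply: epi_cvg_intro => // x; exists (fun=> x); first exact: cvg_cst.
apply: cvge_from_bounds; last exact: up.
move=> a /lu[[A B] /= [xA Boo] AB]; apply: filterS Boo => i Bi.
by apply: (AB (x, i)); split=> //; exact: nbhs_singleton.
Qed.

Lemma epi_cvg_increasing (u_ : nat -> 'cV[R]_n -> \bar R) u :
  (forall i, lower_semicontinuous (u_ i)) ->
  (forall i j x, (i <= j)%N -> (u_ i x <= u_ j x)%E) ->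
  (forall i x, (u_ i x <= u x)%E) ->
  (forall x (a : R), (a%:E < u x)%E -> exists i, (a%:E < u_ i x)%E) ->
  epi_cvg u_ u.
Proof.
move=> lu_ mono le_u sup_u; apply: epi_cvg_pointwise; last first.
  by move=> x b ub; apply: nearW => i; exact: le_lt_trans ub.
move=> x a /sup_u[i /lu_[V Vx Vu]]; exists (V, [set j | (i <= j)%N]).
  by split=> //; exists i.
by move=> [y j] /= [/Vu ay ij]; exact: lt_le_trans (mono _ _ _ ij).
Qed.

End Restriction.

(** * Invariant valuations are constant on functions with flat domains *)

Section InvariantValuation.
Local Open Scope classical_set_scope.
Local Open Scope ring_scope.
Context {R : realType} {n : nat}.

(** The properties that remain of [Z] at the origin once the Legendre transform
    is subtracted. *)
Record invariant_valuation (d : ('cV[R]_n -> \bar R) -> R) : Prop := {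
  iv_valuation : forall u v, conv_sc u -> conv_sc v ->
    conv_sc (fun x => maxe (u x) (v x)) -> conv_sc (fun x => mine (u x) (v x)) ->
    d (fun x => maxe (u x) (v x)) + d (fun x => mine (u x) (v x)) = d u + d v;
  iv_continuous : forall (u_ : nat -> 'cV[R]_n -> \bar R) u,
    (forall i, conv_sc (u_ i)) -> conv_sc u -> epi_cvg u_ u ->
    d (u_ i) @[i --> \oo] --> d u;
  iv_SL : forall (phi : 'M[R]_n) u, \det phi = 1 -> conv_sc u ->
    d (comp_inv phi u) = d u;
  iv_translate : forall y u, conv_sc u -> d (translate y u) = d u;
  iv_addr : forall (c : R) u, conv_sc u -> d (fun x => (u x + c%:E)%E) = d u }.

Definition point0 : 'cV[R]_n -> \bar R := restrict [set 0] (fun=> 0).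

Lemma conv_sc_point0 : conv_sc point0.
Proof.
apply: (@conv_sc_restrict _ _ _ _ 0).
- rewrite (_ : [set 0] = [set x : 'cV[R]_n | `|x| <= 0]).
    exact/closed_fun_le/norm_continuous.
  by apply/seteqP; split=> x /= => [->|]; rewrite ?normr0// normr_le0 => /eqP.
- by move=> x y t _ /= -> ->; rewrite !scaler0 addr0.
- by move=> x ->; rewrite normr0.
- by exists 0.
- exact: cst_continuous.
- by move=> x y t _; rewrite !mulr0 addr0.
Qed.

Context (d : ('cV[R]_n -> \bar R) -> R) (dP : invariant_valuation d).

(** In a basis adapted to the kernel of [nu], the map is diagonal with entries
    [K^-1] on the kernel and [K ^+ n.-1] on a complementary line. *)
Lemma SL_shrink (nu : 'rV[R]_n) (K : R) : (0 < n)%N -> nu != 0 -> K != 0 ->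
  exists phi : 'M[R]_n, \det phi = 1 /\
    forall x : 'cV[R]_n, nu *m x = 0 -> phi *m x = K^-1 *: x.
Proof.
move=> n0 nu0 K0; pose i0 := Ordinal n0.
pose e0 : 'rV[R]_n := delta_mx 0 i0.
pose f : 'M[R]_n := \matrix_(i, j) nu 0 j.
have e0f : e0 *m f = nu by rewrite -rowE; apply/rowP => j; rewrite !mxE.
have [B BU] : {g | g \in unitmx & e0 *m f = e0 *m g}.
  apply: complete_unitmx; rewrite e0f !rank_rV nu0.
  suff -> : e0 != 0 by [].
  by apply/eqP => /rowP/(_ i0)/eqP; rewrite !mxE !eqxx oner_eq0.
rewrite e0f => nuB.
pose D : 'M[R]_n := diag_mx (\row_j (if j == i0 then K ^+ n.-1 else K^-1)).
exists (invmx B *m D *m B); split.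
  rewrite !det_mulmx det_inv mulrAC mulVr; last by rewrite -unitmxE.
  rewrite mul1r det_diag (bigD1 i0)//= mxE eqxx.
  rewrite (eq_bigr (fun=> K^-1)); last by move=> j /negbTE nj; rewrite mxE nj.
  rewrite prodr_const cardC1 card_ord.
  by rewrite exprVn mulfV// expf_neq0.
move=> x nux; rewrite -!mulmxA; set y := B *m x.
have y0 : y i0 0 = 0.
  move: nux; rewrite nuB -mulmxA -/y -rowE => /matrixP/(_ 0 0).
  by rewrite !mxE.
have -> : D *m y = K^-1 *: y.
  apply/colP => i; rewrite mul_diag_mx !mxE.
  by have [->|//] := eqVneq i i0; rewrite mxE in y0; rewrite y0 !mulr0.
by rewrite -scalemxAr /y mulKmx.
Qed.

(** Normalize [u] to have minimum 0 at the origin. Composition with maps that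
    shrink the hyperplane by [k + 1] turns [u] into [x |-> u ((k + 1) x)] on the
    hyperplane, which tends to infinity away from the origin. *)
Lemma flat_const (u : 'cV[R]_n -> \bar R) (nu : 'rV[R]_n) b : (0 < n)%N ->
  conv_sc u -> nu != 0 -> (forall x, u x != +oo%E -> nu *m x = b) ->
  d u = d point0.
Proof.
move=> n0 cu nu0 ub.
have [r [[p up] ur]] := conv_sc_min cu.
pose w (x : 'cV[R]_n) : \bar R := (translate (- p) u x + (- r)%:E)%E.
have cpu : conv_sc (translate (- p) u) by exact: conv_sc_translate.
have cw : conv_sc w by exact: conv_sc_addr.
have <- : d w = d u by rewrite iv_addr// iv_translate.
have w0 : w 0 = 0%E by rewrite /w /translate opprK add0r up -EFinD subrr.
have w_ge0 x : (0 <= w x)%E.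
  by have := leeD2r (- r)%:E (ur (x - - p)); rewrite -EFinD subrr.
have wnu x : w x != +oo%E -> nu *m x = 0.
  rewrite /w /translate opprK => wx.
  have /ub : u (x + p) != +oo%E by apply: contraNneq wx => ->.
  rewrite mulmxDr (ub p) ?up// => /eqP.
  by rewrite -subr_eq0 addrK => /eqP.
have [r0 r0w] : exists r0, forall x, r0 < l1norm x -> ((1 * l1norm x)%:E <= w x)%E.
  by case: cw => _ _ _ _ /supercoercive_l1/(_ 1).
have /choice[phi phiP] : forall k : nat, exists phi : 'M[R]_n, \det phi = 1 /\
    forall x : 'cV[R]_n, nu *m x = 0 -> phi *m x = k.+1%:R^-1 *: x.
  by move=> k; apply: SL_shrink; rewrite // pnatr_eq0.
have phi1 k := (phiP k).1.
have phiU k : phi k \in unitmx by rewrite unitmxE phi1 unitr1.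
have wphi k x : comp_inv (phi k) w x != +oo%E ->
    comp_inv (phi k) w x = w (k.+1%:R *: x).
  move=> /wnu nx; rewrite /comp_inv; congr w.
  have := (phiP k).2 _ nx; rewrite mulKVmx// => xE.
  by rewrite {2}xE scalerA mulfV ?scale1r// pnatr_eq0.
have cw_ k : conv_sc (comp_inv (phi k) w) by exact: conv_sc_comp_inv.
suff wpt : epi_cvg (fun k => comp_inv (phi k) w) point0.
  have := iv_continuous dP cw_ conv_sc_point0 wpt.
  under eq_fun do rewrite iv_SL//.
  by move=> h; apply: (cvg_unique _ (cvg_cst _) h).
apply: epi_cvg_pointwise; last first.
  move=> x c; rewrite /point0; have [->|/eqP x0] := eqVneq x 0; last first.
    by rewrite restrictF.
  by rewrite restrictT// => c0; apply: nearW => k; rewrite /comp_inv mulmx0 w0.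
move=> x a; rewrite /point0; have [->|x0] := eqVneq x 0.
  rewrite restrictT// => a0; exists (setT, setT); first by split; exact: filterT.
  by move=> [y k] _ /=; exact: lt_le_trans a0 (w_ge0 _).
move=> _; have nx0 : 0 < `|x| by rewrite normr_gt0.
pose M := 2 * (`|r0| + `|a| + 1) / `|x|.
have M0 : 0 <= M by rewrite /M divr_ge0// mulr_ge0// !addr_ge0.
exists ([set y : 'cV[R]_n | `|x| / 2 < `|y|], [set k : nat | M <= k%:R]).
  split; last first.
    exists (Num.truncn M).+1 => // k /= Mk; apply/ltW/(lt_le_trans (truncnS_gt _)).
    by rewrite ler_nat.
  apply: (@norm_continuous R 'cV[R]_n x [set t | `|x| / 2 < t]).
  by apply: open_nbhs_nbhs; split; [exact: open_gt|rewrite /=; lra].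
move=> [y k] [/= xy Mk].
have [->|/wphi ->] := eqVneq (comp_inv (phi k) w y) +oo%E; first exact: ltry.
have ky : `|r0| + `|a| + 1 <= `|k.+1%:R *: y|.
  rewrite normrZ ger0_norm//.
  have -> : `|r0| + `|a| + 1 = M * (`|x| / 2).
    by rewrite /M mulrA divfK ?gt_eqF// mulrAC mulfV ?mul1r// pnatr_eq0.
  apply: ler_pM => //; rewrite ?divr_ge0//; last exact: ltW.
  by apply: le_trans Mk _; rewrite ler_nat.
have kl := le_trans ky (norm_le_l1 _).
have := ler_norm r0; have := ler_norm a; have := normr_ge0 r0; have := normr_ge0 a.
move=> h1 h2 h3 h4.
apply: lt_le_trans (r0w (k.+1%:R *: y) _); last lra.
by rewrite lte_fin; lra.
Qed.

End InvariantValuation.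

(** * Simplices in barycentric coordinates *)

Section Simplices.
Local Open Scope classical_set_scope.
Local Open Scope ring_scope.
Context {R : realType} {n : nat}.
Local Notation m := (n + 1)%N.
Implicit Types (x y : 'cV[R]_n) (Q : 'M[R]_m) (a b c : 'rV[R]_m)
  (t : 'cV[R]_m) (i j k : 'I_m) (l : R).

Definition hom x : 'cV[R]_m := col_mx x 1%:M.

Lemma hom_comb x y (t : R) :
  hom (t *: x + (1 - t) *: y) = t *: hom x + (1 - t) *: hom y.
Proof.
rewrite /hom !scale_col_mx add_col_mx -scalerDl.
by rewrite addrCA subrr addr0 scale1r.
Qed.

(** A simplex is represented by the matrix [Q] that maps homogeneous coordinates
    to barycentric coordinates, i.e. the inverse of the matrix whose columns are
    the vertices with a last entry 1 added. Affine functions on the simplex are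
    then rows [a] (the values at the vertices), and [\det Q] is the inverse of
    the signed volume up to the factor [n!]. *)
Definition bary Q x : 'cV[R]_m := Q *m hom x.

Definition simplex Q : set 'cV[R]_n := [set x | forall i, 0 <= bary Q x i 0].

Definition ones : 'rV[R]_m := const_mx 1.

Definition last_row : 'rV[R]_m := row_mx 0 1%:M.

(** The second condition says that barycentric coordinates add up to 1, i.e. that
    the columns of [invmx Q] are points in homogeneous coordinates. *)
Definition barycentric Q := Q \in unitmx /\ ones *m Q = last_row.

Definition point Q t : 'cV[R]_n := usubmx (invmx Q *m t).

Lemma onesE (t : 'cV[R]_m) : (ones *m t) 0 0 = \sum_i t i 0.
Proof. by rewrite mxE; apply: eq_bigr => i _; rewrite mxE mul1r. Qed.

Lemma last_rowE p (A : 'M[R]_(m, p)) : last_row *m A = dsubmx A.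
Proof. by rewrite -[A in LHS]vsubmxK mul_row_col mul0mx add0r mul1mx. Qed.

Lemma bary_ones Q x : barycentric Q -> ones *m bary Q x = 1%:M.
Proof. by move=> [_ Q1]; rewrite mulmxA Q1 last_rowE col_mxKd. Qed.

Lemma bary_sum Q x : barycentric Q -> \sum_i bary Q x i 0 = 1.
Proof. by move=> QB; rewrite -onesE bary_ones// mxE eqxx. Qed.

Lemma bary_le1 Q x i : barycentric Q -> simplex Q x -> bary Q x i 0 <= 1.
Proof.
move=> QB xS; rewrite -(bary_sum x QB) (bigD1 i)//= lerDl sumr_ge0//.
Qed.

Lemma bary_point Q t : barycentric Q -> \sum_i t i 0 = 1 -> bary Q (point Q t) = t.
Proof.
move=> [QU Q1] t1.
rewrite /bary; suff -> : hom (point Q t) = invmx Q *m t by rewrite mulKVmx.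
rewrite -[RHS]vsubmxK /hom /point; congr col_mx.
rewrite -last_rowE -Q1 mulmxA mulmxK//.
by apply/matrixP => i j; rewrite !ord1 onesE t1 mxE.
Qed.

Lemma point_bary Q x : barycentric Q -> point Q (bary Q x) = x.
Proof. by move=> [QU Q1]; rewrite /point /bary mulKmx// col_mxKu. Qed.

Lemma affine_continuous c : continuous (fun x => (c *m hom x) 0 0).
Proof.
have -> : (fun x => (c *m hom x) 0 0) =
    (fun x => \sum_i lsubmx c 0 i * x i 0 + rsubmx c 0 0).
  apply/funext => x; rewrite -[c in LHS]hsubmxK /hom mul_row_col mulmx1 mxE.
  by congr (_ + _); rewrite mxE.
move=> x; apply: (@continuousD _ _ _ (fun x => \sum_i lsubmx c 0 i * x i 0)
  (cst (rsubmx c 0 0))); last exact: cst_continuous.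
exact: sum_coord_continuous.
Qed.

Lemma bary_coordE Q x i : bary Q x i 0 = (row i Q *m hom x) 0 0.
Proof. by rewrite /bary -row_mul !mxE. Qed.

Lemma linE Q a x : (a *m bary Q x) 0 0 = ((a *m Q) *m hom x) 0 0.
Proof. by rewrite mulmxA. Qed.

Lemma bary_comb Q x y (t : R) :
  bary Q (t *: x + (1 - t) *: y) = t *: bary Q x + (1 - t) *: bary Q y.
Proof. by rewrite /bary hom_comb mulmxDr -!scalemxAr. Qed.

Lemma simplex_closed Q : closed (simplex Q).
Proof.
have -> : simplex Q = \bigcap_(i in setT) [set x | 0 <= bary Q x i 0].
  by apply/seteqP; split=> x xS i => [_|]; exact: xS.
apply: closed_bigI => i _; apply: closed_fun_ge.
under eq_fun do rewrite bary_coordE.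
exact: affine_continuous.
Qed.

Lemma simplex_convex Q : cvx_set (simplex Q).
Proof.
move=> x y t /andP[t0 t1] xS yS i; rewrite bary_comb mxE [X in _ <= X + _]mxE [X in _ <= _ + X]mxE.
by rewrite addr_ge0// mulr_ge0// ?subr_ge0.
Qed.

Lemma simplex_bounded Q : barycentric Q ->
  exists r : R, forall x, simplex Q x -> `|x| <= r.
Proof.
move=> QB; exists (\sum_i \sum_j `|invmx Q i j|) => x xS.
apply: norm_le_coord => [|i]; first by do 2 (apply: sumr_ge0 => ? _).
rewrite -{1}(point_bary x QB) mxE.
rewrite [leRHS](bigD1 (lshift 1 i))//= ler_wpDr//.
  by do 2 (apply: sumr_ge0 => ? _).
rewrite mxE (le_trans (ler_norm_sum _ _ _))//; apply: ler_sum => j _.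
by rewrite normrM ler_piMr// ger0_norm ?bary_le1//; exact: xS.
Qed.

Fixpoint maxlin a (s : seq 'rV[R]_m) t : R :=
  if s is b :: s' then Num.max ((b *m t) 0 0) (maxlin a s' t) else (a *m t) 0 0.

Lemma maxlin_le a s t (r : R) : (maxlin a s t <= r) =
  ((a *m t) 0 0 <= r) && all (fun b : 'rV[R]_m => (b *m t) 0 0 <= r) s.
Proof.
elim: s => [|b s IH] /=; first by rewrite andbT.
by rewrite ge_max IH andbCA.
Qed.

Lemma maxlin_eq a s b s' t t' :
  (forall r : R, (maxlin a s t <= r) = (maxlin b s' t' <= r)) ->
  maxlin a s t = maxlin b s' t'.
Proof. by move=> h; apply/eqP; rewrite eq_le h lexx -h lexx. Qed.

Lemma maxlin_continuous Q a s : continuous (fun x => maxlin a s (bary Q x)).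
Proof.
elim: s => [|b s IH] /=.
  under eq_fun do rewrite linE.
  exact: affine_continuous.
have cb : continuous (fun x => (b *m bary Q x) 0 0).
  under eq_fun do rewrite linE.
  exact: affine_continuous.
move=> x; have := continuous_max (cb x) (IH x); exact.
Qed.

Lemma maxlin_convex Q a s : convex_fun (fun x => maxlin a s (bary Q x)).
Proof.
move=> x y t /andP[t0 t1]; rewrite bary_comb.
have lin c : (c *m (t *: bary Q x + (1 - t) *: bary Q y)) 0 0 =
    t * (c *m bary Q x) 0 0 + (1 - t) * (c *m bary Q y) 0 0.
  by rewrite mulmxDr -!scalemxAr !mxE.
elim: s => [|b s IH] /=; first by rewrite lin.
rewrite ge_max lin; apply/andP; split.
  apply: lerD; apply: ler_wpM2l; rewrite ?subr_ge0// le_max lexx//.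
apply: le_trans IH _; apply: lerD; apply: ler_wpM2l; rewrite ?subr_ge0//;
  by rewrite le_max lexx orbT.
Qed.

Lemma conv_sc_part Q (C : set 'cV[R]_n) a s : barycentric Q -> C `<=` simplex Q ->
  closed C -> cvx_set C -> C !=set0 ->
  conv_sc (restrict C (fun x => maxlin a s (bary Q x))).
Proof.
move=> QB CS clC cC C0; have [r Sr] := simplex_bounded QB.
apply: (@conv_sc_restrict _ _ _ _ r) => //.
- by move=> x /CS /Sr.
- exact: maxlin_continuous.
- exact: maxlin_convex.
Qed.

Definition pwl Q a s : 'cV[R]_n -> \bar R :=
  restrict (simplex Q) (fun x => maxlin a s (bary Q x)).

Lemma sum_delta i : \sum_k (delta_mx i 0 : 'cV[R]_m) k 0 = 1.
Proof.
rewrite (bigD1 i)//= big1 ?addr0 ?mxE ?eqxx// => k ki.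
by rewrite mxE (negbTE ki).
Qed.

Lemma vertex_simplex Q i : barycentric Q -> simplex Q (point Q (delta_mx i 0)).
Proof.
move=> QB k; rewrite bary_point ?sum_delta// mxE.
exact: ler0n.
Qed.

Lemma conv_sc_pwl Q a s : barycentric Q -> conv_sc (pwl Q a s).
Proof.
move=> QB; apply: conv_sc_part => //; first exact: simplex_closed.
  exact: simplex_convex.
by exists (point Q (delta_mx (rshift n ord0) 0)); exact: vertex_simplex.
Qed.

(** Right multiplication of the matrix of vertices by [edge i j l] replaces vertex
    [j] by the point [(1 - l) v_i + l v_j] of the edge from [i] to [j]. The other
    part of the simplex is obtained with [edge j i (1 - l)]. *)
Definition edge i j l : 'M[R]_m := 1%:M + (1 - l) *: (delta_mx i j - delta_mx j j).

Lemma edge_colE i j l t k :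
  (edge i j l *m t) k 0 = t k 0 + (1 - l) * (((k == i)%:R - (k == j)%:R) * t j 0).
Proof.
rewrite mulmxDl mul1mx -scalemxAl mulmxBl !mxE; congr (_ + _ * _).
have dE (p q : 'I_m) : \sum_r (delta_mx p q : 'M[R]_m) k r * t r 0 = (k == p)%:R * t q 0.
  rewrite (bigD1 q)//= big1 ?addr0 => [|r rq]; first by rewrite mxE eqxx andbT.
  by rewrite mxE (negbTE rq) andbF mul0r.
by rewrite !dE mulrBl.
Qed.

Lemma edge_rowE i j l a k :
  (a *m edge i j l) 0 k = a 0 k + (1 - l) * ((k == j)%:R * (a 0 i - a 0 j)).
Proof.
rewrite mulmxDr mulmx1 -scalemxAr mulmxBr !mxE; congr (_ + _ * _).
have dE (p q : 'I_m) : \sum_r a 0 r * (delta_mx p q : 'M[R]_m) r k = (k == q)%:R * a 0 p.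
  rewrite (bigD1 p)//= big1 ?addr0 => [|r rp]; first by rewrite mxE eqxx mulrC.
  by rewrite mxE (negbTE rp) mulr0.
by rewrite !dE mulrBr.
Qed.

Lemma edge_mul i j l l' : i != j -> edge i j l *m edge i j l' = edge i j (l * l').
Proof.
move=> ij; apply/matrixP => p q.
have E (A : 'M[R]_m) : A p q = (A *m delta_mx q (0 : 'I_1)) p 0 by rewrite -colE mxE.
rewrite !E -mulmxA !edge_colE !mxE !eqxx (eq_sym j i) (negbTE ij) /=.
ring.
Qed.

Lemma edgeV i j l : i != j -> l != 0 -> edge i j l *m edge i j l^-1 = 1%:M.
Proof. by move=> ij l0; rewrite edge_mul// mulfV// /edge subrr scale0r addr0. Qed.

Lemma edge_unit i j l : i != j -> l != 0 -> edge i j l \in unitmx.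
Proof. by move=> ij l0; have [] := mulmx1_unit (edgeV ij l0). Qed.

(** Row [j] of [edge i j l] has the only nonzero entry [l], on the diagonal. *)
Lemma edge_det i j l : i != j -> \det (edge i j l) = l.
Proof.
move=> ij; rewrite (expand_det_row _ j) (bigD1 j)//= big1 => [|k kj].
  rewrite addr0 !mxE !eqxx (negbTE (_ : j != i)) 1?eq_sym//=.
  rewrite /cofactor addnn -signr_odd odd_double mul1r.
  have -> : row' j (col' j (edge i j l)) = 1%:M.
    apply/matrixP => p q; rewrite !mxE (inj_eq lift_inj).
    by rewrite !(eq_sym _ j) !(negbTE (neq_lift _ _)) !andbF subrr mulr0 addr0.
  by rewrite det1 mulr1; ring.
rewrite !mxE (eq_sym j k) (negbTE kj) (eq_sym j i) (negbTE ij) !eqxx /= subrr.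
by rewrite mulr0 addr0 mul0r.
Qed.

Lemma ones_edge i j l : ones *m edge i j l = ones.
Proof. by apply/rowP => k; rewrite edge_rowE !mxE subrr !mulr0 addr0. Qed.

Lemma barycentric_edge i j l Q : i != j -> l != 0 -> barycentric Q ->
  barycentric (edge i j l *m Q).
Proof.
move=> ij l0 [QU Q1]; split; first by rewrite unitmx_mul edge_unit.
by rewrite mulmxA ones_edge.
Qed.

Lemma maxlin_edge i j l a s t : i != j -> l != 0 ->
  maxlin (a *m edge i j l) [seq b *m edge i j l | b <- s] (edge i j l^-1 *m t) =
  maxlin a s t.
Proof.
move=> ij l0; have E c : c *m edge i j l *m (edge i j l^-1 *m t) = c *m t.
  by rewrite -mulmxA (mulmxA (edge _ _ _)) edgeV// mul1mx.
by elim: s => [|b s IH] /=; rewrite E ?IH.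
Qed.

Lemma simplex_edge Q i j l : i != j -> 0 < l < 1 ->
  simplex (edge i j l^-1 *m Q) =
  simplex Q `&` [set x | 0 <= l * bary Q x i 0 - (1 - l) * bary Q x j 0].
Proof.
move=> ij /andP[l0 l1].
have E x k : bary (edge i j l^-1 *m Q) x k 0 =
    bary Q x k 0 + (1 - l^-1) * (((k == i)%:R - (k == j)%:R) * bary Q x j 0).
  by rewrite /bary -mulmxA edge_colE.
have Ei x : l * bary (edge i j l^-1 *m Q) x i 0 =
    l * bary Q x i 0 - (1 - l) * bary Q x j 0.
  rewrite E eqxx (negbTE ij) subr0 mul1r; field; exact: lt0r_neq0.
have Ej x : bary (edge i j l^-1 *m Q) x j 0 = l^-1 * bary Q x j 0.
  rewrite E eqxx eq_sym (negbTE ij) sub0r mulN1r; ring.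
apply/seteqP; split=> x /=.
  move=> xS; have xj : 0 <= bary Q x j 0.
    by have := xS j; rewrite Ej pmulr_rge0// invr_gt0.
  split; last by rewrite -Ei; apply: mulr_ge0; [exact: ltW|exact: xS].
  move=> k; have [->//|kj] := eqVneq k j; have [->|ki] := eqVneq k i.
    have : 0 <= l * bary Q x i 0 - (1 - l) * bary Q x j 0.
      by rewrite -Ei; apply: mulr_ge0; [exact: ltW|exact: xS].
    move=> h; rewrite -(pmulr_rge0 _ l0).
    have : 0 <= (1 - l) * bary Q x j 0 by apply: mulr_ge0 => //; lra.
    lra.
  by have := xS k; rewrite E (negbTE kj) (negbTE ki) subrr mul0r mulr0 addr0.
move=> [xS h] k; have [->|kj] := eqVneq k j.
  by rewrite Ej; apply: mulr_ge0; [rewrite invr_ge0 ltW|exact: xS].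
have [->|ki] := eqVneq k i; first by rewrite -(pmulr_rge0 _ l0) Ei.
by rewrite E (negbTE kj) (negbTE ki) subrr mul0r mulr0 addr0.
Qed.

Lemma affine_form_neq0 Q c i j : barycentric Q -> c 0 i != c 0 j ->
  lsubmx (c *m Q) != 0.
Proof.
move=> [QU Q1] cij; apply/eqP => c0; move/eqP: cij; apply.
have : c *m Q = (rsubmx (c *m Q) 0 0) *: (ones *m Q).
  rewrite Q1 -[LHS]hsubmxK c0 scale_row_mx scaler0; congr row_mx.
  by apply/matrixP => p q; rewrite !ord1 [in RHS]mxE [1%:M _ _]mxE eqxx mulr1.
rewrite scalemxAl => /(can_inj (mulmxK QU)) ->.
by rewrite !mxE.
Qed.

End Simplices.

(** * Functional equations for the values on simplices *)

Section SimplexValues.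
Local Open Scope classical_set_scope.
Local Open Scope ring_scope.
Context {R : realType} {n : nat} (d : ('cV[R]_n -> \bar R) -> R)
  (dP : invariant_valuation d).
Local Notation m := (n + 1)%N.
Implicit Types (x y : 'cV[R]_n) (Q : 'M[R]_m) (a b c : 'rV[R]_m)
  (i j k : 'I_m) (l : R).

Lemma simplex_edgeC Q i j l : i != j -> 0 < l < 1 ->
  simplex (edge j i (1 - l)^-1 *m Q) =
  simplex Q `&` [set x | l * bary Q x i 0 - (1 - l) * bary Q x j 0 <= 0].
Proof.
move=> ij /andP[l0 l1]; rewrite simplex_edge 1?eq_sym//; last by lra.
congr (_ `&` _); apply/seteqP; split=> x /=; lra.
Qed.

(** The valuation property for the two parts of the cut simplex: their common
    part lies in a hyperplane, where [flat_const] applies. *)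
Lemma pwl_cut Q a s i j l : (0 < n)%N -> barycentric Q -> i != j -> 0 < l < 1 ->
  d (pwl Q a s) + d point0 =
  d (pwl (edge i j l^-1 *m Q) (a *m edge i j l) [seq b *m edge i j l | b <- s]) +
  d (pwl (edge j i (1 - l)^-1 *m Q) (a *m edge j i (1 - l))
       [seq b *m edge j i (1 - l) | b <- s]).
Proof.
move=> n0 QB ij l01; have /andP[l0 l1] := l01.
have ji : j != i by rewrite eq_sym.
have l0' : l != 0 by lra.
have l1' : 1 - l != 0 by lra.
pose alpha x := l * bary Q x i 0 - (1 - l) * bary Q x j 0.
pose v x := maxlin a s (bary Q x).
pose c : 'rV[R]_m := l *: delta_mx 0 i - (1 - l) *: delta_mx 0 j.
have ci : c 0 i = l by rewrite !mxE !eqxx (negbTE ij) /= mulr1 mulr0 subr0.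
have cj : c 0 j = - (1 - l) by rewrite !mxE !eqxx (negbTE ji) /= mulr1 mulr0 sub0r.
have alphaE x : alpha x = (c *m bary Q x) 0 0.
  by rewrite /alpha mulmxBl -!scalemxAl -!rowE !mxE.
have alpha_cont : continuous alpha.
  have -> : alpha = fun x => ((c *m Q) *m hom x) 0 0.
    by apply/funext => x; rewrite alphaE linE.
  exact: affine_continuous.
pose C0 := simplex Q `&` [set x | alpha x = 0].
have E1 : pwl (edge i j l^-1 *m Q) (a *m edge i j l) [seq b *m edge i j l | b <- s]
    = restrict (simplex Q `&` [set x | 0 <= alpha x]) v.
  apply/funext => x; rewrite /pwl simplex_edge// /restrict.
  by case: ifP => // _; rewrite /bary -mulmxA maxlin_edge.
have E2 : pwl (edge j i (1 - l)^-1 *m Q) (a *m edge j i (1 - l))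
      [seq b *m edge j i (1 - l) | b <- s]
    = restrict (simplex Q `&` [set x | alpha x <= 0]) v.
  apply/funext => x; rewrite /pwl simplex_edgeC// /restrict.
  by case: ifP => // _; rewrite /bary -mulmxA maxlin_edge.
have c1 := conv_sc_pwl (a *m edge i j l) [seq b *m edge i j l | b <- s]
  (barycentric_edge ij (invr_neq0 l0') QB).
have c2 := conv_sc_pwl (a *m edge j i (1 - l)) [seq b *m edge j i (1 - l) | b <- s]
  (barycentric_edge ji (invr_neq0 l1') QB).
rewrite E1 E2 in c1 c2 *.
have Emin : (fun x => mine (restrict (simplex Q `&` [set x | 0 <= alpha x]) v x)
    (restrict (simplex Q `&` [set x | alpha x <= 0]) v x)) = pwl Q a s.
  apply/funext => x; rewrite /pwl -/v.
  have [xS|xS] := pselect (simplex Q x); last first.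
    by rewrite !restrictF ?minxx// => -[].
  rewrite [RHS]restrictT//; have [al|al] := leP 0 (alpha x).
    by rewrite restrictT//; apply/min_idPl; rewrite /restrict; case: ifP; rewrite ?leey.
  rewrite restrictF; last by move=> [_ /=]; lra.
  rewrite restrictT; first by apply/min_idPr; rewrite leey.
  by split=> //=; exact: ltW.
have Emax : (fun x => maxe (restrict (simplex Q `&` [set x | 0 <= alpha x]) v x)
    (restrict (simplex Q `&` [set x | alpha x <= 0]) v x)) = restrict C0 v.
  apply/funext => x.
  have [xS|xS] := pselect (simplex Q x); last first.
    by rewrite !restrictF ?maxxx// => -[].
  have [al|al|al] := ltgtP 0 (alpha x).
  - rewrite (@restrictF _ _ (_ `&` [set x | alpha x <= 0])); last by move=> [_ /=]; lra.
    rewrite (@restrictF _ _ C0); last by move=> [_ /=]; lra.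
    by apply/max_idPr; rewrite leey.
  - rewrite (@restrictF _ _ (_ `&` [set x | 0 <= alpha x])); last by move=> [_ /=]; lra.
    rewrite (@restrictF _ _ C0); last by move=> [_ /=]; lra.
    by apply/max_idPl; rewrite leey.
  - by rewrite !restrictT ?maxxx//; split=> //=; rewrite -al.
have c0 : conv_sc (restrict C0 v).
  apply: conv_sc_part => //.
  - by move=> x [].
  - apply: closedI; first exact: simplex_closed.
    have -> : [set x | alpha x = 0] = [set x | alpha x <= 0] `&` [set x | 0 <= alpha x].
      by apply/seteqP; split=> x /= => [->|[h1 h2]]; rewrite ?lexx//; lra.
    by apply: closedI; [exact: closed_fun_le|exact: closed_fun_ge].
  - move=> x y t t01 [xS /= ax] [yS /= ay]; split; first exact: simplex_convex.
    by rewrite /= alphaE bary_comb mulmxDr -!scalemxAr mxE mxE [X in _ + X]mxE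
       -!alphaE ax ay !mulr0 addr0.
  - pose t : 'cV[R]_m := (1 - l) *: delta_mx i 0 + l *: delta_mx j 0.
    have t1 : \sum_k t k 0 = 1.
      under eq_bigr do rewrite mxE [X in X + _]mxE [X in _ + X]mxE.
      rewrite big_split /= -!mulr_sumr !sum_delta; ring.
    exists (point Q t); split.
      move=> k; rewrite bary_point// !mxE.
      by rewrite addr_ge0// mulr_ge0//; lra.
    rewrite /= alphaE bary_point// mulmxDr -!scalemxAr -!colE !mxE.
    rewrite !eqxx (negbTE ji) (eq_sym i) (negbTE ji) !mulr0 !mulr1 subr0 add0r.
    ring.
have dC0 : d (restrict C0 v) = d point0.
  have nu0 : lsubmx (c *m Q) != 0.
    by apply: (@affine_form_neq0 _ _ _ _ i j) => //; rewrite ci cj; lra.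
  apply: (flat_const dP n0 c0 nu0 (b := - rsubmx (c *m Q))) => x.
  rewrite /restrict; case: asboolP => // -[_ /= ax] _.
  have : (c *m Q) *m hom x = 0.
    by apply/matrixP => p q; rewrite !ord1 -linE -alphaE ax mxE.
  rewrite -{1}[c *m Q]hsubmxK /hom mul_row_col mulmx1 => /eqP.
  by rewrite addr_eq0 => /eqP.
have := iv_valuation dP c1 c2; rewrite Emin Emax dC0 addrC => -> //.
exact: conv_sc_pwl.
Qed.

(** Two simplices of the same signed volume correspond under an affine map whose
    linear part has determinant 1. *)
Lemma pwl_det Q Q' a s : barycentric Q -> barycentric Q' -> \det Q = \det Q' ->
  d (pwl Q a s) = d (pwl Q' a s).
Proof.
move=> QB QB'; have [QU Q1] := QB; have [QU' Q1'] := QB'.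
move=> dQ; pose L := invmx Q' *m Q.
have dL : \det L = 1 by rewrite det_mulmx det_inv dQ mulVr// -unitmxE.
have bot : dsubmx L = last_row.
  by rewrite -last_rowE -{1}Q1' /L mulmxA mulmxK.
pose phi := ulsubmx L; pose b := ursubmx L.
have LE : L = block_mx phi b 0 1%:M.
  rewrite -[L in LHS]submxK /dlsubmx /drsubmx bot.
  by rewrite /last_row row_mxKl row_mxKr.
have dphi : \det phi = 1 by move: dL; rewrite LE det_ublock det1 mulr1.
have phiU : phi \in unitmx by rewrite unitmxE dphi unitr1.
have homE x : hom (phi *m x + b) = L *m hom x.
  by rewrite LE /hom mul_block_col mul0mx add0r !mulmx1.
have baryE x : bary Q' (phi *m x + b) = bary Q x.
  by rewrite /bary homE /L -mulmxA mulKVmx.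
have -> : pwl Q a s = comp_inv (invmx phi) (translate (- b) (pwl Q' a s)).
  apply/funext => x; rewrite /comp_inv /translate opprK invmxK.
  rewrite /pwl /restrict baryE.
  by have -> : simplex Q' (phi *m x + b) = simplex Q x by rewrite /simplex /= baryE.
have cQ' := conv_sc_pwl a s QB'.
rewrite (iv_SL dP) ?(iv_translate dP)//; last exact: conv_sc_translate.
by rewrite det_inv dphi invr1.
Qed.

Definition gval Q a : R := d (pwl Q a [::]) - d point0.

Lemma gval_cut Q a i j l : (0 < n)%N -> barycentric Q -> i != j -> 0 < l < 1 ->
  gval Q a = gval (edge i j l^-1 *m Q) (a *m edge i j l) +
    gval (edge j i (1 - l)^-1 *m Q) (a *m edge j i (1 - l)).
Proof.
move=> n0 QB ij l01; rewrite /gval.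
have /= := pwl_cut a [::] n0 QB ij l01; lra.
Qed.

Lemma gval_det Q Q' a : barycentric Q -> barycentric Q' -> \det Q = \det Q' ->
  gval Q a = gval Q' a.
Proof. by move=> QB QB' dQ; rewrite /gval (pwl_det _ _ QB QB'). Qed.

Lemma edge_row_id i j l a : a 0 i = a 0 j -> a *m edge i j l = a.
Proof.
by move=> aij; apply/rowP => k; rewrite edge_rowE aij subrr !mulr0 addr0.
Qed.

(** Bisecting an edge whose ends carry the same value gives two simplices with
    half the volume and the same vertex values. *)
Lemma gval_half_pair Q Q' a i j : (0 < n)%N -> barycentric Q -> barycentric Q' ->
  \det Q' = 2 * \det Q -> i != j -> a 0 i = a 0 j -> gval Q a = 2 * gval Q' a.
Proof.
move=> n0 QB QB' dQ ij aij; have ji : j != i by rewrite eq_sym.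
have h01 : 0 < (2^-1 : R) < 1 by lra.
have hE : 1 - 2^-1 = 2^-1 :> R by lra.
rewrite (gval_cut a n0 QB ij h01) hE invrK !edge_row_id//.
have two0 : (2 : R) != 0 by lra.
rewrite !(@gval_det _ Q' a) ?det_mulmx ?edge_det//; last first.
- exact: barycentric_edge.
- exact: barycentric_edge.
ring.
Qed.

Lemma three_values (f : 'I_m -> R) : (1 < n)%N ->
  exists i j k, [/\ i != j, j != k, i != k, f i <= f k & f k <= f j].
Proof.
move=> n1; have m3 : (2 < m)%N by rewrite addn1.
pose i0 : 'I_m := Ordinal (ltn_trans (ltn_trans (ltn0Sn 0) (ltnSn 1)) m3).
pose i1 : 'I_m := Ordinal (ltn_trans (ltnSn 1) m3).
pose i2 : 'I_m := Ordinal m3.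
have [h01|h01] := leP (f i0) (f i1); have [h12|h12] := leP (f i1) (f i2);
  have [h02|h02] := leP (f i0) (f i2).
- by exists i0, i2, i1.
- by exists i0, i2, i1.
- by exists i0, i1, i2; split=> //; exact: ltW.
- by exists i2, i1, i0; split=> //; exact: ltW.
- by exists i1, i2, i0; split=> //; exact: ltW.
- by exists i1, i0, i2; split=> //; exact: ltW.
- by exists i2, i0, i1; split=> //; exact: ltW.
- by exists i2, i0, i1; split=> //; exact: ltW.
Qed.

(** A cut through the vertex of intermediate value along its level set produces two
    simplices that each have a pair of equal vertex values. This is where at least
    three vertices are needed. *)
Lemma gval_half Q Q' a : (1 < n)%N -> barycentric Q -> barycentric Q' ->
  \det Q' = 2 * \det Q -> gval Q a = 2 * gval Q' a.
Proof.
move=> n1 QB QB' dQ; have n0 := ltnW n1.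
have [i [j [k [ij jk ik aik akj]]]] := three_values (a 0) n1.
have [eik|nik] := eqVneq (a 0 i) (a 0 k); first exact: gval_half_pair dQ ik eik.
have [ejk|njk] := eqVneq (a 0 j) (a 0 k); first exact: gval_half_pair dQ jk ejk.
have ltik : a 0 i < a 0 k by rewrite lt_neqAle nik.
have ltkj : a 0 k < a 0 j by rewrite lt_neqAle eq_sym njk.
have ji : j != i by rewrite eq_sym.
pose l := (a 0 k - a 0 i) / (a 0 j - a 0 i).
have D0 : 0 < a 0 j - a 0 i by lra.
have l01 : 0 < l < 1 by rewrite /l divr_gt0 ?ltr_pdivrMr//; lra.
have /andP[l0 l1] := l01.
have l0' : l != 0 by lra.
have l1' : 1 - l != 0 by lra.
have lE : l * (a 0 j - a 0 i) = a 0 k - a 0 i by rewrite /l divfK//; lra.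
rewrite (gval_cut a n0 QB ij l01) (gval_cut a n0 QB' ij l01) mulrDr.
have iv0 := invr_neq0 l0'; have iv1 := invr_neq0 l1'.
congr (_ + _).
- apply: (gval_half_pair (i := j) (j := k)) => //; try exact: barycentric_edge.
    by rewrite !det_mulmx !edge_det// dQ mulrCA.
  rewrite !edge_rowE eqxx (eq_sym k) (negbTE jk) mul0r mulr0 addr0 mul1r.
  by move: lE; lra.
- apply: (gval_half_pair (i := i) (j := k)) => //; try exact: barycentric_edge.
    by rewrite !det_mulmx !edge_det// dQ mulrCA.
  rewrite !edge_rowE eqxx (eq_sym k) (negbTE ik) mul0r mulr0 addr0 mul1r.
  by move: lE; lra.
Qed.

(** A bisection halves the volume, which [gval_half] turns into a factor 2: the
    volume is the same on both sides. *)
Lemma gval_bisect Q a i j : (1 < n)%N -> barycentric Q -> i != j ->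
  gval Q a = (gval Q (a *m edge i j 2^-1) + gval Q (a *m edge j i 2^-1)) / 2.
Proof.
move=> n1 QB ij; have ji : j != i by rewrite eq_sym.
have h01 : 0 < (2^-1 : R) < 1 by lra.
have hE : 1 - 2^-1 = 2^-1 :> R by lra.
have two0 : (2 : R) != 0 by lra.
rewrite [LHS](gval_cut a (ltnW n1) QB ij h01) hE invrK.
rewrite (@gval_half Q (edge i j 2 *m Q) (a *m edge i j _)) ?det_mulmx ?edge_det//;
  last exact: barycentric_edge.
rewrite (@gval_half Q (edge j i 2 *m Q) (a *m edge j i _)) ?det_mulmx ?edge_det//;
  last exact: barycentric_edge.
lra.
Qed.

End SimplexValues.

(** * Invariant valuations are constant on piecewise affine functions *)

Section PiecewiseLinear.
Local Open Scope classical_set_scope.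
Local Open Scope ring_scope.
Context {R : realType} {n : nat} (d : ('cV[R]_n -> \bar R) -> R)
  (dP : invariant_valuation d) (n1 : (1 < n)%N).
Local Notation m := (n + 1)%N.
Local Notation gval := (gval d).
Implicit Types (x y : 'cV[R]_n) (Q : 'M[R]_m) (a b c : 'rV[R]_m)
  (i j : 'I_m) (l : R).

Let n0 : (0 < n)%N := ltnW n1.

Lemma lin_bound Q a x (r : R) : barycentric Q -> simplex Q x ->
  (forall i, `|a 0 i| <= r) -> `|(a *m bary Q x) 0 0| <= r.
Proof.
move=> QB xS ar; rewrite mxE (le_trans (ler_norm_sum _ _ _))//.
rewrite -[r]mulr1 -(bary_sum x QB) mulr_sumr; apply: ler_sum => i _.
by rewrite normrM (ger0_norm (xS i)) ler_wpM2r.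
Qed.

Lemma lin_ge0 Q a x : simplex Q x -> (forall i, 0 <= a 0 i) ->
  0 <= (a *m bary Q x) 0 0.
Proof. by move=> xS a0; rewrite mxE sumr_ge0// => i _; rewrite mulr_ge0. Qed.

Lemma gval_addc Q a (r : R) : barycentric Q -> gval Q (a + r *: ones) = gval Q a.
Proof.
move=> QB; have ca := conv_sc_pwl a [::] QB.
rewrite /gval -[in RHS](iv_addr dP r ca); congr (d _ - _).
apply/funext => x; rewrite /pwl /restrict; case: ifP => //= _.
rewrite -EFinD; congr EFin.
rewrite mulmxDl -scalemxAl bary_ones// mxE; congr (_ + _).
by rewrite !mxE eqxx mulr1.
Qed.

(** Continuity of [d]: functions with small oscillation converge uniformly to 0 on
    the simplex after subtraction of a constant. *)
Lemma gval_near_const Q (e : R) : barycentric Q -> 0 < e ->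
  exists2 del : R, 0 < del & forall a, (forall i j, `|a 0 i - a 0 j| <= del) ->
    `|gval Q a - gval Q 0| <= e.
Proof.
move=> QB e0; apply: contrapT => no.
have /choice[a_ a_P] : forall k : nat, exists a, (forall i, `|a 0 i| <= k.+1%:R^-1) /\
    e < `|gval Q a - gval Q 0|.
  move=> k; apply: contrapT => nok; apply: no; exists k.+1%:R^-1; first by rewrite invr_gt0.
  move=> a osc; rewrite leNgt; apply/negP => ea; apply: nok.
  exists (a + (- a 0 (rshift n ord0)) *: ones); split; last by rewrite gval_addc.
  by move=> i; rewrite !mxE mulr1; exact: osc.
have cQ b := conv_sc_pwl b [::] QB.
have epi : epi_cvg (fun k => pwl Q (a_ k) [::]) (pwl Q 0 [::]).
  have near0 (e' : R) : 0 < e' -> \forall k \near \oo, k.+1%:R^-1 < e'.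
    by move=> e'0; have := near_infty_natSinv_lt (PosNum e'0).
  have lb k x : simplex Q x -> `|(a_ k *m bary Q x) 0 0| <= k.+1%:R^-1.
    by move=> xS; apply: lin_bound => //; case: (a_P k).
  apply: epi_cvg_pointwise => x a.
    move=> /ereal_between[b]; rewrite lte_fin => ab bx.
    have [_ /(_ x b bx)[V Vx Vb] _ _ _] := cQ 0.
    have [K _ Kab] : \forall k \near \oo, k.+1%:R^-1 < b - a by apply: near0; lra.
    exists (V, [set k | (K <= k)%N]); first by split=> //; exists K.
    move=> [y k] /= [/Vb]; rewrite /pwl /restrict.
    case: asboolP => yS; last by move=> _ _; rewrite ltry.
    rewrite /= mul0mx mxE !lte_fin => b0 Kk.
    have := lb k y yS; rewrite ler_norml => /andP[h _].
    by apply: lt_le_trans h; rewrite ltrNr; apply: lt_trans (Kab k Kk) _; lra.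
  rewrite /pwl /restrict; case: asboolP => // xS.
  rewrite /= mul0mx mxE lte_fin => b0.
  apply: filterS (near0 a b0) => k ka; rewrite lte_fin.
  have := lb k x xS; rewrite ler_norml => /andP[_ h]; exact: le_lt_trans h ka.
have := iv_continuous dP (fun k => cQ (a_ k)) (cQ 0) epi.
move/cvgrPdist_lt => /(_ _ e0)[K _ /(_ K (leqnn K))].
have [_] := a_P K; rewrite /gval opprB addrA subrK distrC; lra.
Qed.

(** Repeated bisection of edges between a vertex with a low value and one with a
    high value shows that [gval Q a] is a mean of values at almost constant rows. *)
Lemma gval_indep Q a : barycentric Q -> gval Q a = gval Q 0.
Proof.
move=> QB; apply/eqP; rewrite -subr_eq0 -normr_le0.
apply/ler_addgt0Pl => e e0; rewrite addr0.
have [del del0 small] := gval_near_const QB e0.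
(* Induction on an interval that contains all the vertex values. A step shrinks
   its length [D >= del] to [3 D / 4], which is at most [D - del / 4]; so lengths
   in arithmetic progression suffice. *)
pose width (N : nat) : R := del + N%:R * (del / 4).
suff main N : forall b lo, (forall i, lo <= b 0 i <= lo + width N) ->
    `|gval Q b - gval Q 0| <= e.
  pose B := \sum_i `|a 0 i|.
  have aB i : `|a 0 i| <= B by rewrite /B (bigD1 i)//= lerDl sumr_ge0.
  pose N := Num.truncn (2 * B / (del / 4)).
  apply: (main N.+1 a (- B)) => i.
  have := aB i; rewrite ler_norml => /andP[h1 h2]; rewrite h1 /=.
  have : 2 * B / (del / 4) < N.+1%:R by exact: truncnS_gt.
  rewrite ltr_pdivrMr; last by lra.
  rewrite /width; lra.
elim: N => [|N IH] b lo blo.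
  apply: small => i j; have := blo i; have := blo j.
  rewrite /width mul0r addr0 ler_norml => /andP[? ?] /andP[? ?]; apply/andP; split; lra.
have wE : width N.+1 = width N + del / 4.
  by rewrite /width -natr1 mulrDl mul1r addrA.
have wd : del <= width N.+1.
  by rewrite /width lerDl mulr_ge0//; lra.
set D := width N.+1 in blo wE wd.
(* The midpoint of a value in the lowest quarter and one in the highest quarter
   lies in the middle half; so each bisection of such an edge reduces the number
   of values outside the middle half. When no such edge is left, one of the two
   extreme quarters is free of values. *)
pose outer b := [pred i : 'I_m | (b 0 i < lo + D / 4) || (lo + 3 * D / 4 < b 0 i)].
move: {-1}(#|outer b|) (leqnn #|outer b|) => c.
elim: c b blo => [|c IHc] b blo bc.
  apply: (IH b (lo + D / 4)) => i.
  have /card0_eq/(_ i) : #|outer b| = 0%N by apply/eqP; rewrite -leqn0.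
  rewrite !inE => /negbT; rewrite negb_or -!leNgt.
  by move=> /andP[h1 h2]; apply/andP; split; lra.
have [/existsP[i bi]|/existsPn nlow] := boolP [exists i, b 0 i < lo + D / 4]; last first.
  apply: (IH b (lo + D / 4)) => i; have := nlow i; rewrite -leNgt => h1.
  have /andP[_ h2] := blo i; apply/andP; split; lra.
have [/existsP[j bj]|/existsPn nhigh] := boolP [exists j, lo + 3 * D / 4 < b 0 j]; last first.
  apply: (IH b lo) => j; have := nhigh j; rewrite -leNgt => h1.
  have /andP[h2 _] := blo j; apply/andP; split; lra.
have ij : i != j by apply/eqP => E; move: bi bj; rewrite E; lra.
have ji : j != i by rewrite eq_sym.
have /andP[bi1 bi2] := blo i; have /andP[bj1 bj2] := blo j.
have child p q : p != q -> b 0 p + b 0 q = b 0 i + b 0 j -> q \in outer b ->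
    `|gval Q (b *m edge p q 2^-1) - gval Q 0| <= e.
  move=> pq sm qo.
  have bE k : (b *m edge p q 2^-1) 0 k = if k == q then (b 0 i + b 0 j) / 2 else b 0 k.
    rewrite edge_rowE; case: eqVneq => [->|_]; last by rewrite mul0r mulr0 addr0.
    by rewrite -sm mul1r; lra.
  apply: IHc => [k|].
    rewrite bE; case: eqP => _; last exact: blo.
    by apply/andP; split; lra.
  rewrite -ltnS; apply: leq_trans bc; apply: proper_card.
  apply/properP; split.
    apply/fintype.subsetP => k; rewrite !inE bE; case: eqP => // _ /orP[]; lra.
  by exists q => //; rewrite inE bE eqxx negb_or -!leNgt; apply/andP; split; lra.
rewrite (gval_bisect dP b n1 QB ij).
have := child i j ij erefl; rewrite inE bj orbT => /(_ isT).
have := child j i ji (addrC _ _); rewrite inE bi => /(_ isT).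
rewrite !ler_norml => /andP[? ?] /andP[? ?]; apply/andP; split; lra.
Qed.

(** By [gval_indep] the value may be computed along the rows that are 0 at the last
    vertex and [k] at the others; these functions increase to the indicator
    function of that vertex. *)
Lemma gval_eq0 Q a : barycentric Q -> gval Q a = 0.
Proof.
move=> QB; rewrite gval_indep//; have [QU Q1] := QB.
pose o : 'I_m := rshift n ord0.
pose b : 'rV[R]_m := ones - delta_mx 0 o.
pose p := point Q (delta_mx o 0).
have bE x : (b *m bary Q x) 0 0 = 1 - bary Q x o 0.
  by rewrite mulmxBl bary_ones// -rowE !mxE eqxx.
have cQ k := conv_sc_pwl (k%:R *: b) [::] QB.
have epi : epi_cvg (fun k => pwl Q (k%:R *: b) [::]) (translate p point0).
  have valE k x : simplex Q x -> pwl Q (k%:R *: b) [::] x =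
      (k%:R * (1 - bary Q x o 0))%:E.
    by move=> xS; rewrite /pwl restrictT//= -scalemxAl mxE bE.
  have pS : simplex Q p by exact: vertex_simplex.
  have bp : bary Q p o 0 = 1 by rewrite bary_point ?sum_delta// mxE !eqxx.
  have t1 x : simplex Q x -> x - p != 0 -> bary Q x o 0 < 1.
    move=> xS xp; rewrite lt_neqAle bary_le1// andbT; apply: contra_neq xp => t1.
    suff -> : x = p by rewrite subrr.
    rewrite -(point_bary x QB); congr point; apply/colP => i.
    rewrite [RHS]mxE eqxx andbT; have [->|io] := eqVneq i o; first by rewrite t1.
    have := bary_sum x QB; rewrite (bigD1 o)//= t1 => /eqP.
    rewrite -subr_eq0 addrAC subrr add0r psumr_eq0 => [/allP/(_ i)|j _]; last exact: xS.
    by rewrite mem_index_enum io => /(_ isT) /eqP.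
  apply: epi_cvg_increasing.
  - by move=> k; case: (cQ k).
  - move=> k k' x kk'; apply: restrict_le => // xS /=.
    rewrite -!scalemxAl [leLHS]mxE [leRHS]mxE; apply: ler_wpM2r; last by rewrite ler_nat.
    by rewrite bE subr_ge0 bary_le1.
  - move=> k x; rewrite /translate /point0 /restrict.
    case: asboolP => [/= xp|_]; last by rewrite leey.
    have -> : x = p by apply/eqP; rewrite -subr_eq0 xp.
    by rewrite valE// bp subrr mulr0.
  - move=> x c; rewrite /translate /point0; have [xp|xp] := eqVneq (x - p) 0.
      rewrite restrictT// => c0; exists 0%N.
      have -> : x = p by apply/eqP; rewrite -subr_eq0 xp.
      by rewrite valE// mul0r.
    move=> _; have [xS|xS] := pselect (simplex Q x); last first.
      by exists 0%N; rewrite /pwl restrictF// ltry.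
    have h := t1 x xS xp.
    exists (Num.truncn (c / (1 - bary Q x o 0))).+1; rewrite valE// lte_fin.
    by rewrite -ltr_pdivrMr ?truncnS_gt// subr_gt0.
have cp : conv_sc (translate p point0 : 'cV[R]_n -> \bar R).
  exact/conv_sc_translate/conv_sc_point0.
have := iv_continuous dP cQ cp epi.
rewrite (iv_translate dP); last exact: conv_sc_point0.
have -> : (fun k : nat => d (pwl Q (k%:R *: b) [::])) = fun=> gval Q 0 + d point0.
  by apply/funext => k; rewrite -(gval_indep (k%:R *: b) QB) /gval subrK.
move=> h; have := cvg_unique _ (cvg_cst _) h => /(_ _) E.
by apply: (addIr (d point0)); rewrite add0r; exact: E.
Qed.

(** Outer induction on the number of affine functions, inner induction on the
    number of vertices at which the first two of them, [a] and [b], differ. If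
    [a - b] has a sign at the vertices, one of them is redundant; otherwise a cut
    at the zero of [a - b] on an edge reduces the number of such vertices. *)
Lemma pwl_const Q a s : barycentric Q -> d (pwl Q a s) = d point0.
Proof.
move: {-1}(size s) (leqnn (size s)) => N; elim: N s Q a => [|N IH] s Q a sN QB.
  move: sN; rewrite leqn0 => /nilP ->.
  by apply/eqP; rewrite -subr_eq0; apply/eqP; exact: gval_eq0.
case: s sN => [_|b s]; first exact: IH.
rewrite /= ltnS => sN.
have drop_b Q' a' b' s' : barycentric Q' -> (forall i, 0 <= (a' - b') 0 i) ->
    pwl Q' a' (b' :: s') = pwl Q' a' s'.
  move=> QB' ab; apply/funext => x; rewrite /pwl /restrict.
  case: asboolP => // xS; congr EFin; apply: maxlin_eq => r.
  have := lin_ge0 xS ab; rewrite mulmxBl mxE [X in _ + X]mxE => h.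
  rewrite !maxlin_le /=; case: lerP => //= ar.
  by rewrite (le_trans _ ar)//; lra.
have drop_a Q' a' b' s' : barycentric Q' -> (forall i, (a' - b') 0 i <= 0) ->
    pwl Q' a' (b' :: s') = pwl Q' b' s'.
  move=> QB' ab; rewrite -[RHS](drop_b _ _ a')//.
    apply/funext => x; rewrite /pwl /restrict.
    case: asboolP => // xS; congr EFin; apply: maxlin_eq => r.
    by rewrite !maxlin_le /= andbCA.
  by move=> i; rewrite -opprB mxE oppr_ge0.
pose supp (a b : 'rV[R]_m) := [pred i : 'I_m | (a - b) 0 i != 0].
move: {-1}(#|supp a b|) (leqnn #|supp a b|) => c.
elim: c a b s sN Q QB => [|c IHc] a b s sN Q QB abc.
  have /card0_eq ab0 : #|supp a b| = 0%N by apply/eqP; rewrite -leqn0.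
  rewrite drop_b// ?IH// => i; have := ab0 i; rewrite !inE => /negbFE/eqP ->.
  exact: lexx.
have [/existsP[i ai]|/existsPn nopos] := boolP [exists i, 0 < (a - b) 0 i]; last first.
  by rewrite drop_a// ?IH// => i; have := nopos i; rewrite -leNgt.
have [/existsP[j aj]|/existsPn noneg] := boolP [exists j, (a - b) 0 j < 0]; last first.
  by rewrite drop_b// ?IH// => j; have := noneg j; rewrite -leNgt.
have ij : i != j by apply/eqP => E; move: ai aj; rewrite E; lra.
have ji : j != i by rewrite eq_sym.
pose l := (a - b) 0 i / ((a - b) 0 i - (a - b) 0 j).
have D0 : 0 < (a - b) 0 i - (a - b) 0 j by lra.
have l01 : 0 < l < 1 by rewrite /l divr_gt0// ltr_pdivrMr//; lra.
have /andP[l0 l1] := l01.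
have l0' : l^-1 != 0 by rewrite invr_neq0; lra.
have l1' : (1 - l)^-1 != 0 by rewrite invr_neq0; lra.
have lE : l * ((a - b) 0 i - (a - b) 0 j) = (a - b) 0 i by rewrite /l divfK//; lra.
have child p q l' : p != q -> (a - b) 0 q + (1 - l') * ((a - b) 0 p - (a - b) 0 q) = 0 ->
    (a - b) 0 q != 0 -> (#|supp (a *m edge p q l') (b *m edge p q l')| <= c)%N.
  move=> pq z0 qn0; rewrite -ltnS; apply: leq_trans abc; apply: proper_card.
  have E k : (a *m edge p q l' - b *m edge p q l') 0 k =
      if k == q then 0 else (a - b) 0 k.
    rewrite -mulmxBl edge_rowE; case: eqVneq => [->|_]; first by rewrite mul1r.
    by rewrite mul0r mulr0 addr0.
  apply/properP; split.
    by apply/fintype.subsetP => k; rewrite !inE E; case: (k == q); rewrite ?eqxx.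
  by exists q; rewrite !inE ?E ?eqxx.
have cut := pwl_cut dP a (b :: s) n0 QB ij l01.
have h1 : d (pwl (edge i j l^-1 *m Q) (a *m edge i j l)
    [seq b *m edge i j l | b <- b :: s]) = d point0.
  apply: IHc; first by rewrite size_map.
    exact: barycentric_edge.
  by apply: child => //; [move: lE; lra|lra].
have h2 : d (pwl (edge j i (1 - l)^-1 *m Q) (a *m edge j i (1 - l))
    [seq b *m edge j i (1 - l) | b <- b :: s]) = d point0.
  apply: IHc; first by rewrite size_map.
    exact: barycentric_edge.
  by apply: child => //; [move: lE; lra|lra].
by apply: (addIr (d point0)); rewrite cut h1 h2.
Qed.

End PiecewiseLinear.

(** * Density of piecewise affine functions *)

Section Density.
Local Open Scope classical_set_scope.
Local Open Scope ring_scope.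
Context {R : realType} {n : nat}.
Implicit Types (x y : 'cV[R]_n) (u : 'cV[R]_n -> \bar R).

Definition aff (l : 'cV[R]_n * R) x : R := dotp x l.1 + l.2.

Definition minorant u (l : 'cV[R]_n * R) := forall y, ((aff l y)%:E <= u y)%E.

Lemma aff_continuous l : continuous (aff l).
Proof.
move=> x; apply: (@continuousD _ _ _ (fun x => dotp x l.1) (cst l.2)).
  exact: dotp_continuous.
exact: cst_continuous.
Qed.

Lemma sq_norm_ge x : `|x| ^+ 2 <= dotp x x.
Proof.
have d0 : 0 <= dotp x x by apply: sumr_ge0 => i _; rewrite -expr2 sqr_ge0.
rewrite -(@sqr_sqrtr _ (dotp x x))// ler_sqr ?nnegrE ?sqrtr_ge0//.
apply: norm_le_coord => [|i]; first exact: sqrtr_ge0.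
rewrite -sqrtr_sqr ler_wsqrtr// /dotp (bigD1 i)//= expr2 lerDl.
by apply: sumr_ge0 => j _; rewrite -expr2 sqr_ge0.
Qed.

Lemma dotp_ge0 x : 0 <= dotp x x.
Proof. by apply: le_trans (sq_norm_ge x); rewrite sqr_ge0. Qed.

Lemma sq_normD x y (t : R) : dotp (x + t *: y) (x + t *: y) =
  dotp x x + 2 * t * dotp x y + t ^+ 2 * dotp y y.
Proof. rewrite !dotpDl !dotpDr !dotpZl !dotpZr (dotpC y x); ring. Qed.

Lemma sq_dist_continuous (p : 'cV[R]_n) (K : R) :
  continuous (fun x => K * dotp (x - p) (x - p)).
Proof.
have -> : (fun x => K * dotp (x - p) (x - p)) =
    (fun x => \sum_i (K * (x i 0 - p i 0)) * (x i 0 - p i 0)).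
  apply/funext => x; rewrite /dotp mulr_sumr; apply: eq_bigr => i _.
  by rewrite !mxE mulrA.
apply: continuous_big => [|i _ x]; first exact: add_continuous.
have cc : {for x, continuous (fun x : 'cV[R]_n => x i 0 - p i 0)}.
  apply: (@continuousB _ _ _ (fun x : 'cV[R]_n => x i 0) (cst (p i 0))).
    exact: coord_continuous.
  exact: cst_continuous.
apply: (@continuousM _ _ (fun x : 'cV[R]_n => K * (x i 0 - p i 0))) => //.
apply: (@continuousM _ _ (cst K)) => //; exact: cst_continuous.
Qed.

Lemma quadratic_ge0_linear (X T : R) : 0 <= T ->
  (forall t, 0 < t <= 1 -> 0 <= t * X + t ^+ 2 * T) -> 0 <= X.
Proof.
move=> T0 h; rewrite leNgt; apply/negP => X0.
have D0 : 0 < T + 1 - X by lra.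
pose t := - X / (T + 1 - X).
have tD : t * (T + 1 - X) = - X by rewrite /t divfK//; lra.
have t0 : 0 < t by rewrite /t divr_gt0//; lra.
have t1 : t <= 1 by rewrite /t ler_pdivrMr//; lra.
have := h t; rewrite t0 t1 => /(_ isT).
rewrite expr2 -mulrA -mulrDr pmulr_rge0// => h'.
have : 0 < t * (1 - X) by rewrite mulr_gt0//; lra.
lra.
Qed.

(** Minimize [u + K |. - x0|^2] and let [p] be a minimizer. The first order
    condition at [p] says that [u] is above the affine function with slope
    [- 2 K (p - x0)] that agrees with it at [p]. At [x0] this affine function is at
    least the minimum, which exceeds [r] for large [K] since [u > r] near [x0] and
    [u] is bounded below. *)
Lemma affine_minorant u x0 (r : R) : conv_sc u -> (r%:E < u x0)%E ->
  exists l, minorant u l /\ r < aff l x0.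
Proof.
move=> cu ru; have [uNy lu vu pu su] := cu.
have [mu [_ umu]] := conv_sc_min cu.
have [V Vx0 Vr] := lu x0 r ru.
have [del /= del0 delV] := (nbhs_ballP _ _).1 Vx0.
pose K : R := (`|r - mu| + 1) / del ^+ 2.
have K0 : 0 < K by rewrite divr_gt0 ?exprn_gt0// ltr_pwDr.
pose q x := dotp (x - x0) (x - x0).
have q0 x : 0 <= q x by exact: dotp_ge0.
pose w x : \bar R := (u x + (K * q x)%:E)%E.
have [om [[p wp] wom]] : exists om, is_min w om.
  apply: coercive_min.
  - by move=> x; rewrite /w adde_eq_ninfty negb_or uNy.
  - apply: lsc_addr => //; exact: sq_dist_continuous.
  - by have [x ux] := pu; exists x; rewrite /w; case: (u x) ux.
  - move=> M; have [s su'] := supercoercive_coercive su M; exists s => x sx.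
    apply: le_trans (su' x sx) _; rewrite /w leeDl// lee_fin mulr_ge0//.
    exact: ltW.
have [ups up] : exists s : R, u p = s%:E.
  by move: wp; rewrite /w; have := uNy p; case: (u p) => // s _ _; exists s.
have omE : om = ups + K * q p.
  by move: wp; rewrite /w up -EFinD => -[].
have rom : r < om.
  have [pd|pd] := ltP `|p - x0| del.
    have : (r%:E < u p)%E.
      by apply/Vr/delV; rewrite -ball_normE /= distrC.
    rewrite up lte_fin omE => h; apply: lt_le_trans h _.
    by rewrite lerDl mulr_ge0// ltW.
  have h1 : mu <= ups by have := umu p; rewrite up lee_fin.
  have h2 : `|r - mu| + 1 <= K * q p.
    apply: (@le_trans _ _ (K * del ^+ 2)); first by rewrite /K divfK// expf_neq0// gt_eqF.
    rewrite ler_pM2l//; apply: le_trans (sq_norm_ge _).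
    by rewrite ler_sqr ?nnegrE// ltW.
  have := ler_norm (r - mu); lra.
pose s := - (2 * K) *: (p - x0).
exists (s, ups - dotp p s); split; last first.
  rewrite /aff /=; have -> : dotp x0 s + (ups - dotp p s) = ups - dotp (p - x0) s.
    by rewrite dotpDl dotpNl; ring.
  rewrite /s dotpZr -/(q p); have : 0 <= K * q p by rewrite mulr_ge0// ltW.
  lra.
move=> y; case E: (u y) => [psi| |]; last 2 first.
- by rewrite leey.
- by have := uNy y; rewrite E.
rewrite lee_fin /aff /=.
pose B := dotp (p - x0) (y - p); pose C := dotp (y - p) (y - p).
have sE : dotp y s - dotp p s = - (2 * K) * B.
  by rewrite -dotpNl -dotpDl /s dotpZr dotpC.
suff : 0 <= psi - ups + 2 * K * B by lra.
apply: (@quadratic_ge0_linear _ (K * C)).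
  by apply: mulr_ge0; [exact: ltW|exact: dotp_ge0].
move=> t /andP[t0 t1]; pose z := t *: y + (1 - t) *: p.
have zE : z - x0 = (p - x0) + t *: (y - p).
  by apply/colP => i; rewrite /z !mxE; ring.
have qz : q z = q p + 2 * t * B + t ^+ 2 * C.
  by rewrite /q zE sq_normD.
have t01 : 0 <= t <= 1 by rewrite ltW.
have : (om%:E <= (t * psi + (1 - t) * ups)%:E + (K * q z)%:E)%E.
  apply: le_trans (wom z) _; apply: leeD => //.
  by apply: le_trans (vu y p t t01) _; rewrite up E -!EFinM -EFinD.
by rewrite -EFinD lee_fin omE qz; lra.
Qed.

Lemma rat_approx x (e : R) : 0 < e -> exists q : 'cV[rat]_n,
  `|x - map_mx ratr q| <= e.
Proof.
move=> e0; have /choice[q qP] : forall i, exists q : rat, x i 0 - e < ratr q < x i 0 + e.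
  move=> i; have [q] := @rat_in_itvoo R (x i 0 - e) (x i 0 + e) ltac:(lra).
  by rewrite in_itv /=; exists q.
exists (\col_i q i); apply: norm_le_coord => [|i]; first exact: ltW.
rewrite !mxE; have /andP[? ?] := qP i.
by rewrite ler_norml; apply/andP; split; lra.
Qed.

(** Choose a minorant, if there is one, for each lower bound by a rational on a ball
    with rational center and radius [1 / (k + 1)]. *)
Lemma countable_minorants u : conv_sc u -> exists l : nat -> 'cV[R]_n * R,
  (forall i, minorant u (l i)) /\
  forall x (r : R), (r%:E < u x)%E -> exists i, r < aff (l i) x.
Proof.
move=> cu; have [l0 ml0] : exists l, minorant u l.
  have [uNy _ _ pu _] := cu; have [x [r ux]] := proper_fin uNy pu.
  have [l [ml _]] := @affine_minorant u x (r - 1) cu ltac:(by rewrite ux lte_fin; lra).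
  by exists l.
pose T := ('cV[rat]_n * rat * nat)%type.
pose P (t : T) (l : 'cV[R]_n * R) := minorant u l /\
  forall y, `|y - map_mx ratr t.1.1| < t.2.+1%:R^-1 -> ratr t.1.2 < aff l y.
have /choice[f fP] : forall t : T, exists l, minorant u l /\ ((exists l', P t l') -> P t l).
  move=> t; have [[l Pl]|no] := pselect (exists l, P t l).
    by exists l; split=> //; case: Pl.
  by exists l0.
pose l i := if unpickle i is Some t then f t else l0.
exists l; split=> [i|x r ru].
  by rewrite /l; case: unpickle => // t; case: (fP t).
have [l1 [ml1 rl1]] := affine_minorant cu ru.
have [s] := rat_in_itvoo rl1; rewrite in_itv /= => /andP[rs sl].
have : nbhs x [set y | ratr s < aff l1 y].
  apply: (@aff_continuous l1 x [set t | ratr s < t]).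
  by apply: open_nbhs_nbhs; split; [exact: open_gt|].
move/nbhs_ballP => [e /= e0 eP].
have [k _ /(_ k (leqnn k)) ke] := near_infty_natSinv_lt (PosNum (divr_gt0 e0 (ltr0Sn R 1))).
have k0 : 0 < k.+1%:R^-1 :> R by rewrite invr_gt0.
have [q xq] := rat_approx x (divr_gt0 k0 (ltr0Sn R 1)).
have [_] := fP (q, s, k); case.
  exists l1; split=> // y /= yq; apply: eP; rewrite -ball_normE /=.
  have -> : x - y = (x - map_mx ratr q) - (y - map_mx ratr q).
    by rewrite opprB addrA subrK.
  apply: le_lt_trans (ler_normB _ _) _.
  move: ke k0 xq yq; move: (k.+1%:R^-1 : R) => dk /=; lra.
move=> _ /(_ x) /= h; exists (pickle (q, s, k)).
rewrite /l pickleK; apply: lt_trans rs _; apply: h.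
by apply: le_lt_trans xq _; rewrite gtr_pMr// invf_lt1// ltr1n.
Qed.

Local Notation m := (n + 1)%N.

(** The barycentric coordinates of [x] are [(x_i + k + 1) / N] and 1 minus their sum,
    so that the simplex is given by [x_i >= - (k + 1)] and
    [\sum_i x_i <= n (k + 1)]. *)
Definition big_simplex (k : nat) : 'M[R]_m :=
  let N : R := (2 * n * k.+1)%:R in
  block_mx 1%:M 0 (- const_mx 1) 1%:M *m
  block_mx (N^-1)%:M (const_mx (k.+1%:R / N)) 0 1%:M.

Lemma big_simplex_barycentric k : (0 < n)%N -> barycentric (big_simplex k).
Proof.
move=> n0; split.
  rewrite unitmx_mul !unitmxE det_lblock det_ublock !det1 det_scalar !mulr1 unitr1 /=.
  rewrite unitrX// unitfE invr_eq0 pnatr_eq0 -lt0n !muln_gt0 n0//.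
rewrite /big_simplex mulmxA.
have -> : ones *m block_mx 1%:M 0 (- const_mx 1) 1%:M = last_row :> 'rV[R]_m.
  have -> : (ones : 'rV[R]_m) = row_mx (const_mx 1) 1%:M.
    apply/rowP => i; case: (split_ordP i) => j ->; rewrite ?row_mxEl ?row_mxEr !mxE//.
    by rewrite ord1 eqxx.
  by rewrite mul_row_block !mulmx1 mulmx0 add0r mul1mx addrN.
by rewrite last_rowE block_mxEv col_mxKd.
Qed.

Lemma big_simplex_mem x : (0 < n)%N -> \forall k \near \oo, simplex (big_simplex k) x.
Proof.
move=> n0; exists (Num.truncn `|x|) => // k /= xk i.
have xk1 : `|x| <= k.+1%:R.
  by apply/ltW/(lt_le_trans (truncnS_gt _)); rewrite ler_nat ltnS.
have xi j : - k.+1%:R <= x j 0 <= k.+1%:R.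
  by rewrite -ler_norml; apply: le_trans (coord_le_norm x j) xk1.
set N : R := (2 * n * k.+1)%:R.
have N0 : 0 < N by rewrite ltr0n !muln_gt0 n0.
rewrite /bary /big_simplex -/N /hom -mulmxA !mul_block_col !mulmx1 !mul1mx !mul0mx.
rewrite addr0 add0r mul_scalar_mx.
case: (split_ordP i) => j ->; rewrite ?col_mxEu ?col_mxEd !mxE ?ord1 ?eqxx.
  have := xi j => /andP[h _]; rewrite mulrC -mulrDl divr_ge0//.
  by rewrite -lerBlDr sub0r.
rewrite mulr1n addrC.
have E : \sum_(j < n) (2 * k.+1%:R / N) = 1.
  rewrite sumr_const card_ord -[LHS]mulr_natl mulrA.
  have -> : n%:R * (2 * k.+1%:R) = N by rewrite /N !natrM mulrCA mulrA.
  by rewrite mulfV ?gt_eqF.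
rewrite -[X in _ <= X + _]E -big_split /=; apply: sumr_ge0 => i' _; rewrite !mxE.
have -> : 2 * k.+1%:R / N + - 1 * (N^-1 * x i' 0 + k.+1%:R / N) =
    (k.+1%:R - x i' 0) / N.
  by move: (k.+1%:R : R) => c; ring.
by rewrite divr_ge0 ?subr_ge0 ?(ltW N0)//; case/andP: (xi i').
Qed.

(** The maxima of the first minorants, restricted to growing simplices, epi-converge
    to [u]. *)
Theorem invariant_valuation_const (d : ('cV[R]_n -> \bar R) -> R) u : (1 < n)%N ->
  invariant_valuation d -> conv_sc u -> d u = d point0.
Proof.
move=> n1 dP cu; have n0 := ltnW n1.
have [l [ml lu]] := countable_minorants cu.
pose Q k := big_simplex k.
have QB k : barycentric (Q k) by exact: big_simplex_barycentric.
(* The vertex values of the minorant [l i] on the [k]-th simplex. *)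
pose r k i : 'rV[R]_m := row_mx (l i).1^T (l i).2%:M *m invmx (Q k).
have rE k i x : (r k i *m bary (Q k) x) 0 0 = aff (l i) x.
  rewrite /r /bary mulmxA mulmxKV; last by case: (QB k).
  rewrite /hom mul_row_col mulmx1 mxE [X in _ + X]mxE eqxx mulr1n; congr (_ + _).
  by rewrite mxE; apply: eq_bigr => j _; rewrite mxE mulrC.
pose v k := pwl (Q k) (r k 0%N) [seq r k i | i <- iota 0 k.+1].
have cv k : conv_sc (v k) by exact: conv_sc_pwl.
have vle k x (c : R) : simplex (Q k) x -> (forall i, aff (l i) x <= c) ->
    (v k x <= c%:E)%E.
  move=> xS lc; rewrite /v /pwl restrictT// lee_fin maxlin_le rE lc andTb.
  by apply/allP => _ /mapP[i _ ->]; rewrite rE.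
have vge k i x : (i <= k)%N -> ((aff (l i) x)%:E <= v k x)%E.
  move=> ik; rewrite /v /pwl /restrict; case: asboolP => xS; last by rewrite leey.
  rewrite lee_fin; set M := maxlin _ _ _.
  have : M <= M by [].
  rewrite {1}/M maxlin_le => /andP[_ /allP/(_ (r k i))]; rewrite rE; apply.
  by apply: map_f; rewrite mem_iota add0n ltnS.
have epi : epi_cvg v u.
  apply: epi_cvg_pointwise => x a.
    move=> /lu[i ai]; exists ([set y | a < aff (l i) y], [set k | (i <= k)%N]).
      split; last by exists i.
      apply: (@aff_continuous (l i) x [set t | a < t]).
      by apply: open_nbhs_nbhs; split; [exact: open_gt|].
    move=> [y k] /= [ay ik]; apply: lt_le_trans (vge k i y ik).
    by rewrite lte_fin.
  case E: (u x) => [c| |] // ca; last by case: cu => /(_ x); rewrite E.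
  apply: filterS (big_simplex_mem x n0) => k xS.
  apply: le_lt_trans ca; apply: vle => // i.
  by have := ml i x; rewrite E lee_fin.
have := iv_continuous dP cv cu epi.
under eq_fun do rewrite (pwl_const dP n1)//.
by move=> h; exact/esym/(cvg_unique _ (cvg_cst _) h).
Qed.

End Density.

(** * Characterization of the Legendre transform *)

Section Characterization.
Local Open Scope classical_set_scope.
Local Open Scope ring_scope.
Context {R : realType} {n : nat}.
Implicit Types (x y : 'cV[R]_n) (u : Conv_sc R n).

Lemma Conv_sc_eq u (v : Conv_sc R n) : conv_fun u = conv_fun v -> u = v.
Proof. by case: u v => [u cu] [v cv] /= E; subst v; congr MkConv; exact: Prop_irrelevance. Qed.

Definition leg u x : R := fenchel u x.

Lemma leg_epi_continuous : epi_continuous leg.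
Proof. by move=> u_ u uu x; apply: fenchel_epi_cvg => //; [move=> i|]; exact: conv_scP. Qed.

Lemma leg_SL_contravariant : SL_contravariant leg.
Proof. by move=> phi phi1 u x; apply: fenchel_comp_inv => //; exact: conv_scP. Qed.

Lemma leg_valuation : valuation leg.
Proof. by move=> u v umax umin x; apply: fenchel_valuation => //; exact: conv_scP. Qed.

Lemma leg_translation_conjugation : translation_conjugation leg.
Proof.
move=> u y; split=> x; first exact/fenchel_translate/conv_scP.
exact: fenchel_add_linear.
Qed.

(** [Z] minus the Legendre transform at the origin, extended by 0 to functions
    outside of the domain of [Z] so that no proofs have to be carried around. *)
Definition normalized (Z : Conv_sc R n -> 'cV[R]_n -> R) (f : 'cV[R]_n -> \bar R) : R :=
  if pselect (conv_sc f) is left cf then Z (MkConv cf) 0 - leg (MkConv cf) 0 else 0.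

Lemma normalizedE Z f (cf : conv_sc f) :
  normalized Z f = Z (MkConv cf) 0 - leg (MkConv cf) 0.
Proof.
rewrite /normalized; case: pselect => // cf'.
by rewrite (_ : cf' = cf)//; exact: Prop_irrelevance.
Qed.

Lemma translation_conjugation_addr Z u z y (v : Conv_sc R n) :
  translation_conjugation Z ->
  conv_fun v = (fun x => u x + (- dotp z y)%:E)%E -> Z v 0 = Z u 0 + dotp z y.
Proof.
move=> ZT vE.
have -> : v = translate_conv y (add_linear_conv z
    (translate_conv (- y) (add_linear_conv (- z) u))).
  by apply: Conv_sc_eq; rewrite vE addr_translate_linear.
rewrite (ZT _ _).1 (ZT _ _).2 (ZT _ _).1 (ZT _ _).2 sub0r opprK addNr.
by rewrite dotpNl dotpNr opprK (dotpC 0) -(scale0r 0) dotpZr mul0r addr0.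
Qed.

Lemma normalized_invariant Z : (0 < n)%N -> epi_continuous Z -> SL_contravariant Z ->
  valuation Z -> translation_conjugation Z -> invariant_valuation (normalized Z).
Proof.
move=> n0 Zc ZS Zv ZT.
have dotp0 y : dotp 0 y = 0 :> R by rewrite -(scale0r 0) dotpZl mul0r.
split.
- move=> u v cu cv cmax cmin; rewrite !normalizedE.
  have := Zv (MkConv cu) (MkConv cv) cmax cmin 0.
  have := leg_valuation (u := MkConv cu) (v := MkConv cv) cmax cmin 0.
  lra.
- move=> u_ u cu_ cu uu; under eq_fun do rewrite (normalizedE Z (cu_ _)).
  rewrite (normalizedE Z cu); apply: cvgB.
    exact: (Zc (fun i => MkConv (cu_ i)) (MkConv cu) uu 0).
  exact: (@leg_epi_continuous (fun i => MkConv (cu_ i)) (MkConv cu) uu 0).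
- move=> phi u phi1 cu; rewrite (normalizedE Z cu).
  rewrite (normalizedE Z (conv_sc_comp_inv phi1 cu)).
  have := ZS phi phi1 (MkConv cu) 0; rewrite mulmx0 /comp_inv_conv /= => ->.
  have := leg_SL_contravariant phi1 (MkConv cu) 0.
  by rewrite mulmx0 /comp_inv_conv /= => ->.
- move=> y u cu; rewrite (normalizedE Z cu).
  rewrite (normalizedE Z (conv_sc_translate y cu)).
  have := (ZT (MkConv cu) y).1 0; rewrite /translate_conv /= => ->.
  have := (leg_translation_conjugation (MkConv cu) y).1 0; rewrite /translate_conv /= => ->.
  by rewrite dotp0 !addr0.
- move=> c u cu; rewrite (normalizedE Z cu) (normalizedE Z (conv_sc_addr c n0 cu)).
  have [z zz] := @exists_unit_vector R n n0.
  have cE : (fun x => (u x + c%:E)%E) =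
      (fun x => MkConv cu x + (- dotp z (- c *: z))%:E)%E.
    by apply/funext => x; rewrite dotpZr zz mulr1 opprK.
  rewrite (@translation_conjugation_addr Z (MkConv cu) z (- c *: z))//.
  rewrite (@translation_conjugation_addr leg (MkConv cu) z (- c *: z))//; last first.
    exact: leg_translation_conjugation.
  ring.
Qed.

End Characterization.

Local Open Scope ring_scope.

Theorem theorem1p1 (R : realType) (n : nat) (n_ge3 : (3 <= n)%N)
    (Z : Conv_sc R n -> 'cV[R]_n -> R) :
  [/\ epi_continuous Z, SL_contravariant Z, valuation Z
    & translation_conjugation Z] <->
  exists c : R, forall (u : Conv_sc R n) (x : 'cV[R]_n),
    (Z u x)%:E = (legendre u x + c%:E)%E.
Proof.
have n1 : (1 < n)%N := ltnW n_ge3.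
have n0 : (0 < n)%N := ltnW n1.
split=> [[Zc ZS Zv ZT]|[c Zc]].
  exists (normalized Z point0) => u x.
  rewrite legendre_fenchel; last exact: conv_scP.
  have dP := normalized_invariant n0 Zc ZS Zv ZT.
  have cxu := conv_scP (add_linear_conv (- x) u).
  rewrite -(invariant_valuation_const n1 dP cxu) (normalizedE Z cxu) -EFinD.
  have -> : MkConv cxu = add_linear_conv (- x) u by exact: Conv_sc_eq.
  rewrite (ZT u (- x)).2 (leg_translation_conjugation u (- x)).2 sub0r opprK.
  by rewrite addrC subrK.
have ZE u x : Z u x = leg u x + c.
  by have := Zc u x; rewrite legendre_fenchel; [case|exact: conv_scP].
split.
- move=> u_ u uu x; rewrite ZE; under eq_fun do rewrite ZE.
  by apply: cvgD; [exact: leg_epi_continuous|exact: cvg_cst].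
- by move=> phi phi1 u x; rewrite !ZE leg_SL_contravariant.
- move=> u v umax umin x; rewrite !ZE.
  by have := leg_valuation umax umin x; lra.
- move=> u y; have [h1 h2] := leg_translation_conjugation u y.
  by split=> x; rewrite !ZE ?h1 ?h2//; ring.
Qed.
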